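(* Let $k$ be a field of prime characteristic $p>0$, let $M\cong\mathbb{Z}^d$ be a free abelian group of rank $d\ge1$, let $S\subset M$ be a finitely generated submonoid that generates $M$ as a group, and let $R=k[S]$. Let $\sigma^\vee=\operatorname{cone}(S)\subset M\otimes_{\mathbb{Z}}\mathbb{R}\cong\mathbb{R}^d$. Let $I$ and $\mathfrak{a}$ be monomial ideals of $R$ of finite colength, with $I=(x^{\mathbf b}\mid\mathbf b\in\mathcal{B})$ and $\mathfrak{a}=(x^{\mathbf a}\mid\mathbf a\in\mathcal{A})$ for finite sets $\mathcal{A},\mathcal{B}\subset S$, and let $H$ be the convex hull of $\mathcal{A}$. Let $t\in\mathbb{R}_{>0}$. If we set $$\mathcal{P}_t=\sigma^\vee\setminus(\mathcal{B}+tH+\sigma^\vee),$$ then $e_{HK}(\mathfrak{a}^t;I)=\operatorname{vol}\overline{\mathcal{P}_t}$, where $\overline{\mathcal{P}_t}$ is the closure of $\mathcal{P}_t$ in the Euclidean topology on $\mathbb{R}^d$ and $\operatorname{vol}$ denotes the usual Euclidean volume on $\mathbb{R}^d$.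
   Context: $x^{\mathbf v}$ ($\mathbf v\in S$) denotes the monomial of $k[S]$ with exponent $\mathbf v$. $\operatorname{cone}(S)$ is the set of non-negative real linear combinations of elements of $S$. Sums of sets are Minkowski sums. The identification $M\otimes\mathbb{R}\cong\mathbb{R}^d$ comes from $M\cong\mathbb{Z}^d$. $I^{[p^e]}$ is the ideal generated by $\{r^{p^e}\mid r\in I\}$ and $\lambda_R$ denotes length. The joint Hilbert-Kunz multiplicity is $$e_{HK}(\mathfrak{a}^t;I)=\lim_{e\to\infty}\frac{1}{p^{ed}}\lambda_R\!\left(\frac{R}{\mathfrak{a}^{\lceil tp^e\rceil}I^{[p^e]}}\right).$$ *)

(* Defs.v *)
From HB Require Import structures.
From mathcomp Require Import all_boot all_order all_algebra finmap.
From mathcomp Require Import all_classical all_reals all_analysis.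
From mathcomp.multinomials Require Import -(notations) monalg.

Set Implicit Arguments.
Unset Strict Implicit.
Unset Printing Implicit Defensive.

Import Order.TTheory GRing.Theory Num.Theory.
Import numFieldNormedType.Exports.

Local Open Scope classical_set_scope.
Local Open Scope ring_scope.

(* multinomials only makes malg K k a ring when K has no nontrivial units,
   which excludes non-pointed affine monoids; here K is any commutative monoid,
   written additively. *)
Section MonoidAlgebra.
Variables (k : fieldType) (K : nmodType).

Definition monoid_algebra : Type := (malg K k).
HB.instance Definition _ := GRing.Zmodule.copy monoid_algebra (malg K k).

Implicit Types f g h : (malg K k).

Definition mon (v : K) : monoid_algebra := mkmalgU v 1.

Definition mamul (f g : monoid_algebra) : monoid_algebra :=
  \sum_(u <- msupp f) \sum_(v <- msupp g)
    mkmalgU (u + v)%R (mcoeff u f * mcoeff v g).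

Lemma mamulw (d1 d2 : {fset K}) f g :
    (msupp f `<=` d1)%fset -> (msupp g `<=` d2)%fset ->
  mamul f g = \sum_(u <- d1) \sum_(v <- d2)
    mkmalgU (u + v)%R (mcoeff u f * mcoeff v g).
Proof.
move=> le_d1 le_d2; rewrite /mamul (big_fset_incl _ le_d1) /=.
  apply/eq_bigr=> u _; apply/big_fset_incl => // v _ /mcoeff_outdom ->.
  by rewrite mulr0 monalgU0.
move=> u _ /mcoeff_outdom fu.
by rewrite big1 => // v _; rewrite fu mul0r monalgU0.
Qed.

Lemma mamulC : commutative mamul.
Proof.
move=> f g; rewrite /mamul exchange_big /=.
by apply/eq_bigr=> u _; apply/eq_bigr=> v _; rewrite addrC mulrC.
Qed.

Lemma mamul0l : left_zero 0 mamul.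
Proof. by move=> g; rewrite /mamul msupp0 big_seq_fset0. Qed.

Lemma mamulUU c1 c2 (u v : K) :
  mamul (mkmalgU u c1) (mkmalgU v c2) = mkmalgU (u + v)%R (c1 * c2).
Proof. by rewrite (mamulw msuppU_le msuppU_le) !big_seq_fset1 !mcoeffUU. Qed.

Lemma mamulDl : left_distributive mamul +%R.
Proof.
move=> f1 f2 g.
rewrite [X in _ = X + _](mamulw (fsubsetUl _ (msupp f2)) (fsubset_refl _)).
rewrite [X in _ = _ + X](mamulw (fsubsetUr (msupp f1) _) (fsubset_refl _)).
rewrite (mamulw (msuppD_le _ _) (fsubset_refl _)).
rewrite -big_split /=; apply/eq_bigr=> u _.
rewrite -big_split /=; apply/eq_bigr=> v _.
by rewrite mcoeffD mulrDl monalgUD.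
Qed.

Lemma mamulDr : right_distributive mamul +%R.
Proof. by move=> f g h; rewrite mamulC mamulDl !(mamulC f). Qed.

Lemma mamul0r : right_zero 0 mamul.
Proof. by move=> f; rewrite mamulC mamul0l. Qed.

Lemma mamul1l : left_id (mon 0) mamul.
Proof.
move=> g; rewrite (mamulw msuppU_le (fsubset_refl _)) big_seq_fset1.
rewrite [RHS]monalgE; apply/eq_bigr=> v _.
by rewrite mcoeffUU mul1r add0r.
Qed.

Lemma mamul_suml (I : Type) (r : seq I) (F : I -> monoid_algebra) g :
  mamul (\sum_(i <- r) F i) g = \sum_(i <- r) mamul (F i) g.
Proof.
exact: (big_morph (mamul^~ g) (fun _ _ => mamulDl _ _ _) (mamul0l g)).
Qed.

Lemma mamul_sumr (I : Type) (r : seq I) (F : I -> monoid_algebra) g :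
  mamul g (\sum_(i <- r) F i) = \sum_(i <- r) mamul g (F i).
Proof.
exact: (big_morph (mamul g) (fun _ _ => mamulDr _ _ _) (mamul0r g)).
Qed.

Lemma mamulA : associative mamul.
Proof.
have EL f g : mamul f g =
    \sum_(u <- msupp f) mamul (mkmalgU u (mcoeff u f)) g.
  by rewrite {1}(monalgE f) mamul_suml.
have ER f g : mamul f g =
    \sum_(v <- msupp g) mamul f (mkmalgU v (mcoeff v g)).
  by rewrite mamulC EL; apply/eq_bigr=> v _; rewrite mamulC.
move=> f g h; rewrite (EL f (mamul g h)) (EL f g) mamul_suml.
apply/eq_bigr=> u _; rewrite (EL g h) mamul_sumr (ER _ g) mamul_suml.
apply/eq_bigr=> v _; rewrite (ER _ h) mamul_sumr [RHS](ER _ h).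
apply/eq_bigr=> w _.
by rewrite !mamulUU addrA mulrA.
Qed.

Lemma mamon0_neq0 : mon 0 != 0.
Proof.
by apply/eqP => /malgP /(_ 0%R); rewrite mcoeffUU mcoeff0 => /eqP;
  rewrite oner_eq0.
Qed.

HB.instance Definition _ := GRing.Zmodule_isComNzRing.Build monoid_algebra
  mamulA mamulC mamul1l mamulDl mamon0_neq0.

End MonoidAlgebra.

Arguments mon {k K} v.

Section Submonoid.
Variables (M : zmodType) (S : addrClosed M).

Record submonoid := Submonoid { smval : M; smvalP : smval \in S }.
HB.instance Definition _ := [isSub for smval].
HB.instance Definition _ := [Choice of submonoid by <:].

Fact submonoid_addr_closed : addr_closed (fun v : M => v \in S).
Proof. exact: (conj (rpred0 S) (@rpredD _ S)). Qed.
HB.instance Definition _ := GRing.SubChoice_isSubNmodule.Build M _ submonoid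
  submonoid_addr_closed.

Definition finitely_generated_monoid : Prop :=
  exists2 gens : seq M, {subset gens <= S} &
    forall T : addrClosed M, {subset gens <= T} -> {subset S <= T}.

Definition generates_group : Prop :=
  forall G : zmodClosed M, {subset S <= G} -> forall v : M, v \in G.

End Submonoid.

Section Ideals.
Variable A : comNzRingType.
Implicit Types (G I J : set A).

Definition is_ideal I : Prop :=
  [/\ I 0, (forall x y, I x -> I y -> I (x + y))
         & (forall r x, I x -> I (r * x))].

Definition ideal_gen G : set A := smallest is_ideal G.

Definition ideal_mul I J : set A := ideal_gen [set x * y | x in I & y in J].

Definition ideal_exp I (n : nat) : set A := iter n (ideal_mul I) setT.

Definition frobenius_power I (q : nat) : set A := ideal_gen [set r ^+ q | r in I].

(* The length of A / J as an A-module: submodules of A / J correspond to ideals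
   of A containing J. *)
Definition colength (R : realType) J : \bar R :=
  ereal_sup [set (n%:R)%:E | n in [set n : nat | exists c : nat -> set A,
    [/\ forall i, (i <= n)%N -> is_ideal (c i),
        J `<=` c 0%N
      & forall i, (i < n)%N -> c i `<` c i.+1]]].

Definition eHK_seq (R : realType) (p d : nat) (a : set A) (t : R) I (e : nat)
    : \bar R :=
  (colength R (ideal_mul (ideal_exp a `|Num.ceil (t * (p ^ e)%:R)|%N)
                         (frobenius_power I (p ^ e)))
   * ((p ^ (e * d))%:R^-1)%:E)%E.

Definition eHK (R : realType) (p d : nat) (a : set A) (t : R) I : \bar R :=
  limn (eHK_seq p d a t I).

End Ideals.

Definition monomial_ideal (k : fieldType) (K : nmodType) (B : set K)
    : set (monoid_algebra k K) :=
  ideal_gen [set mon v | v in B].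

Section Euclidean.
Variables (R : realType) (d : nat).
Implicit Types X Y : set 'rV[R]_d.

Definition cone X : set 'rV[R]_d :=
  [set x | exists (n : nat) (c : 'I_n -> R) (s : 'I_n -> 'rV[R]_d),
    [/\ forall i, 0 <= c i, forall i, X (s i) & x = \sum_i c i *: s i]].

Definition convex_hull X : set 'rV[R]_d :=
  [set x | exists (n : nat) (c : 'I_n -> R) (s : 'I_n -> 'rV[R]_d),
    [/\ forall i, 0 <= c i, \sum_i c i = 1, forall i, X (s i)
      & x = \sum_i c i *: s i]].

Definition minkowski_sum X Y : set 'rV[R]_d := [set x + y | x in X & y in Y].

(* Lebesgue outer measure, computed with countable coverings by closed boxes; on
   closed sets it is Lebesgue measure. Only meaningful for 0 < d: padding a
   covering uses degenerate boxes of volume 0. *)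
Definition vol X : \bar R :=
  ereal_inf [set (\sum_(0 <= n <oo) (\prod_(i < d) (ab.2 n 0 i - ab.1 n 0 i))%:E)%E
    | ab in [set ab : (nat -> 'rV[R]_d) * (nat -> 'rV[R]_d) |
        (forall n i, ab.1 n 0 i <= ab.2 n 0 i) /\
        X `<=` \bigcup_n [set x | forall i, ab.1 n 0 i <= x 0 i <= ab.2 n 0 i]]].

End Euclidean.

Section RealPicture.
Variables (R : realType) (d : nat) (M : zmodType) (S : addrClosed M).
Variable phi : M -> 'rV[int]_d.

(* v |-> v (x) 1, with M (x) R identified with R^d through phi. *)
Definition realify (v : M) : 'rV[R]_d := map_mx (fun z : int => z%:~R) (phi v).

Definition sigma_dual : set 'rV[R]_d := cone (realify @` [set v | v \in S]).

Definition P_region (A B : set (submonoid S)) (t : R) : set 'rV[R]_d :=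
  let sigma := sigma_dual in
  let pts (C : set (submonoid S)) := [set realify (\val v) | v in C] in
  let H := convex_hull (pts A) in
  sigma `\`
    minkowski_sum (minkowski_sum (pts B) [set t *: x | x in H]) sigma.

End RealPicture.

(* Main.v *)
Require Import Defs.
From HB Require Import structures.
From mathcomp Require Import all_boot all_order all_algebra finmap.
From mathcomp Require Import all_classical all_reals all_analysis.
From mathcomp Require Import zify ring lra.
From mathcomp.multinomials Require Import -(notations) monalg.

Set Implicit Arguments.
Unset Strict Implicit.
Unset Printing Implicit Defensive.

Import Order.TTheory GRing.Theory Num.Theory.
Import numFieldNormedType.Exports.

Local Open Scope classical_set_scope.
Local Open Scope ring_scope.

(** The ideal [a^n I^[q]], with [q = p^e] and [n] the ceiling of [t q], is monomial. Its
    exponents are the elements of [q B + n A + S], where [n A] denotes the sums of [n]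
    elements of [A]: in characteristic [p] the Frobenius power of a monomial ideal is
    generated by the [q]-th powers of its monomials ([frobenius_power_monomial]). So the
    length of the quotient is the number of exponents of [S] outside this set
    ([colength_supported]), and the theorem is an asymptotic count of lattice points.
    Finite colength of [I] and [a] means that each misses finitely many exponents
    ([finite_compl_of_colength]); when [S] has nonzero units this takes chains of
    non-monomial ideals.

    Let [sigma] be the cone of [S] and [Q = B + t H + sigma], so that the region is
    [P = sigma \ Q]. There is a fixed [w] in [S] such that every missing exponent lies
    in [sigma] but not in [w + q Q], and every lattice point of [w + sigma] outside
    [q Q] is a missing exponent ([exponents_sub], [deep_point]). One summand of [w]
    is a conductor of [S] in its saturation, another pays for rounding the coefficients
    of convex combinations of [A] down to integers, and a third is deep in the
    interior of [sigma].

    Replacing [sigma] by [w + sigma], or [q Q] by [w + q Q], changes the set only along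
    a boundary layer: the points [z] of a set [X] stable under translation by [w] for
    which [z - w] is not in [X]. Each line in direction [w] has at most one such
    point, so a cube of side [O(q)] in dimension [d] has [O(q^(d-1))] of them
    ([boundary_layer_count]). Let [N] be the number of missing exponents. Covering
    [closure P] with cubes of side [1/q] gives
    [q^d vol (closure P) <= N + O(q^(d-1))] ([vol_le_cells]). Conversely the density of
    lattice points of a compact set is asymptotically at most the volume of each of its
    covers ([lattice_points_le_cover]), so [N <= q^d vol (closure P) + o(q^d)]. The
    limit is [cvg_ncard_vol]. *)

(** * Products and powers of monomial ideals *)

Section Ideals.

Lemma ideal_sum (A : comNzRingType) (J : set A) (I : eqType) (r : seq I)
    (F : I -> A) :
  is_ideal J -> (forall i, i \in r -> J (F i)) -> J (\sum_(i <- r) F i).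
Proof.
by move=> [J0 JD _] JF; rewrite big_seq; apply: (big_ind J) => // ? ?; apply: JD.
Qed.

Lemma ideal_gen_is_ideal (A : comNzRingType) (G : set A) :
  is_ideal (ideal_gen G).
Proof.
split.
- by move=> J [[J0 _ _] _].
- by move=> x y Gx Gy J JG; case: (JG) => -[_ JD _] _; apply: JD; [apply: Gx|apply: Gy].
- by move=> r x Gx J JG; case: (JG) => -[_ _ JM] _; exact: (JM _ _ (Gx J JG)).
Qed.

Lemma sub_ideal_gen (A : comNzRingType) (G : set A) : G `<=` ideal_gen G.
Proof. by move=> x Gx J [_]; apply. Qed.

Lemma ideal_gen_sub (A : comNzRingType) (G J : set A) :
  is_ideal J -> G `<=` J -> ideal_gen G `<=` J.
Proof. by move=> iJ GJ x; apply. Qed.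

End Ideals.

Section Supported.
Variables (k : fieldType) (K : nmodType).
Implicit Types (f g : monoid_algebra k K) (E : set K).

Definition upset (E : set K) := forall u s, E u -> E (u + s).

Definition upclosure (B : set K) : set K :=
  [set v | exists b s, B b /\ v = b + s].

(** The k-span of the monomials with exponent in [E]; for [E] closed under
    translation by [K] these are exactly the monomial ideals, and every ideal
    below is brought to this form. *)
Definition supported (E : set K) : set (monoid_algebra k K) :=
  [set f | forall v, mcoeff v f != 0 -> E v].

Lemma upset_upclosure B : upset (upclosure B).
Proof. by move=> u s [b [s' [Bb ->]]]; exists b, (s' + s); rewrite addrA. Qed.

Lemma supported0 E : supported E 0.
Proof. move=> v; rewrite mcoeff0.
by rewrite eqxx. Qed.

Lemma supportedD E f g : supported E f -> supported E g -> supported E (f + g).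
Proof.
move=> Ef Eg v; rewrite mcoeffD => fg0.
have [fv0|/Ef//] := eqVneq (mcoeff v f) 0.
by apply: Eg; move: fg0; rewrite fv0 add0r.
Qed.

Lemma supported_sum E (I : Type) (r : seq I) (P : pred I)
    (F : I -> monoid_algebra k K) :
  (forall i, P i -> supported E (F i)) -> supported E (\sum_(i <- r | P i) F i).
Proof.
move=> EF; apply: (big_ind (supported E)) => //.
- exact: supported0.
- by move=> f g; exact: supportedD.
Qed.

Lemma supportedU E (v : K) (c : k) :
  E v -> supported E (mkmalgU v c : monoid_algebra k K).
Proof.
by move=> Ev u; rewrite mcoeffU; case: (v =P u) => [<- //|_]; rewrite /= mulr0n eqxx.
Qed.

Lemma mkmalgU_mon (v : K) (c : k) :
  (mkmalgU v c : monoid_algebra k K) = (mkmalgU 0 c : monoid_algebra k K) * mon v.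
Proof. by rewrite [RHS]mamulUU mulr1 add0r. Qed.

Lemma monD (u v : K) : mon (u + v) = mon u * mon v :> monoid_algebra k K.
Proof. by rewrite [RHS]mamulUU mulr1. Qed.

Lemma sum_monomials f :
  f = \sum_(v <- msupp f) (mkmalgU v (mcoeff v f) : monoid_algebra k K).
Proof. exact: monalgE. Qed.

Lemma supported_is_ideal E : upset E -> is_ideal (supported E).
Proof.
move=> upE; split; [exact: supported0|exact: supportedD|].
move=> r f Ef; rewrite [r * f](_ : _ = mamul r f)// /mamul.
apply: supported_sum => u _; rewrite big_seq; apply: supported_sum => v vf.
apply: supportedU; rewrite addrC; apply: upE; apply: Ef.
by rewrite mcoeff_neq0.
Qed.

(** An element is the sum of its terms, so an ideal that contains the monomials
    contains their span. *)
Lemma supported_sub_ideal E (J : set (monoid_algebra k K)) :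
  is_ideal J -> (forall v, E v -> J (mon v)) -> supported E `<=` J.
Proof.
move=> iJ EJ f Ef; rewrite [f]sum_monomials; apply: ideal_sum => // v vf.
rewrite mkmalgU_mon; case: iJ => _ _ JM; apply/JM/EJ/Ef.
by rewrite mcoeff_neq0.
Qed.

Lemma monomial_idealE (B : set K) :
  monomial_ideal B = supported (upclosure B).
Proof.
apply/seteqP; split.
  apply: ideal_gen_sub; first exact/supported_is_ideal/upset_upclosure.
  by move=> _ [v Bv <-]; apply: supportedU; exists v, 0; rewrite addr0.
apply: supported_sub_ideal; first exact: ideal_gen_is_ideal.
move=> _ [b [s [Bb ->]]]; rewrite monD mulrC.
have [_ _ JM] := ideal_gen_is_ideal [set (mon v : monoid_algebra k K) | v in B].
by apply: JM; apply: sub_ideal_gen; exists b.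
Qed.

Definition addset (B C : set K) : set K := [set b + c | b in B & c in C].

Lemma ideal_mul_monomial (B C : set K) :
  ideal_mul (monomial_ideal B : set (monoid_algebra k K)) (monomial_ideal C)
  = monomial_ideal (addset B C).
Proof.
apply/seteqP; split.
  apply: ideal_gen_sub; rewrite [monomial_ideal (addset _ _)]monomial_idealE.
    exact/supported_is_ideal/upset_upclosure.
  move=> _ [f Bf [g Cg <-]]; move: Bf Cg; rewrite !monomial_idealE => Bf Cg.
  rewrite [f * g](_ : _ = mamul f g)// /mamul big_seq.
  apply: supported_sum => u uf; rewrite big_seq; apply: supported_sum => v vg.
  apply: supportedU; rewrite -mcoeff_neq0 in uf; rewrite -mcoeff_neq0 in vg.
  have [b [s [Bb ->]]] := Bf _ uf; have [c [s' [Cc ->]]] := Cg _ vg.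
  by exists (b + c), (s + s'); split; [exists b => //; exists c|rewrite addrACA].
rewrite {1}/monomial_ideal; apply: ideal_gen_sub; first exact: ideal_gen_is_ideal.
move=> _ [_ [b Bb [c Cc <-]] <-]; rewrite monD; apply: sub_ideal_gen.
by exists (mon b); [|exists (mon c) => //]; apply: sub_ideal_gen; [exists b|exists c].
Qed.

Definition nfold (A : set K) n : set K := iter n (addset A) [set 0].

Lemma ideal_exp_monomial (A : set K) n :
  ideal_exp (monomial_ideal A : set (monoid_algebra k K)) n
  = monomial_ideal (nfold A n).
Proof.
elim: n => [|n IH]; last by rewrite /ideal_exp /nfold !iterS -ideal_mul_monomial -IH.
rewrite /ideal_exp/= monomial_idealE; apply/esym/seteqP; split => // f _ v _.
by exists 0, v; rewrite add0r.
Qed.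

Lemma mon_exp (v : K) n : mon v ^+ n = mon (v *+ n) :> monoid_algebra k K.
Proof. by elim: n => [|n IH]; rewrite ?mulr0n // exprS IH mulrS monD. Qed.

(** In characteristic [p] the map [r |-> r ^+ (p ^ e)] is additive, so it sends a
    combination of the monomials [b + s] to a combination of the
    [p ^ e * b + p ^ e * s], and no mixed terms appear. *)
Lemma frobenius_power_monomial (B : set K) p e : p \in [pchar k] ->
  frobenius_power (monomial_ideal B : set (monoid_algebra k K)) (p ^ e)
  = monomial_ideal [set b *+ (p ^ e) | b in B].
Proof.
move=> hp; have hpA : p \in [pchar monoid_algebra k K].
  have := hp; rewrite !inE => /andP[-> /eqP p0]/=.
  have -> : (p%:R : monoid_algebra k K) = mkmalgU 0 (p%:R : k).
    exact/esym/(raddfMn (@mkmalgU K k 0)).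
  by rewrite p0 monalgU0.
apply/seteqP; split.
  apply: ideal_gen_sub; rewrite [monomial_ideal [set _ | _ in _]]monomial_idealE.
    exact/supported_is_ideal/upset_upclosure.
  move=> _ [f Bf <-]; move: Bf; rewrite monomial_idealE => Bf.
  (* The Frobenius of the k-algebra is additive, so powers are taken term by term. *)
  have -> : f ^+ (p ^ e) =
      \sum_(v <- msupp f) (mkmalgU v (mcoeff v f) : monoid_algebra k K) ^+ (p ^ e).
    rewrite {1}[f]sum_monomials.
    elim: (enum_fset (msupp f)) => [|v s IH].
      by rewrite !big_nil expr0n expn_eq0 (gtn_eqF (prime_gt0 (pcharf_prime hp))).
    rewrite !big_cons -IH exprDn_pchar // pnatX orbC.
    by rewrite pnatE ?hpA ?orbT// (pcharf_prime hp).
  rewrite big_seq; apply: supported_sum => v vf.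
  rewrite mkmalgU_mon exprMn mon_exp.
  have [_ _ JM] := supported_is_ideal (@upset_upclosure [set b *+ (p ^ e) | b in B]).
  apply: JM; apply: supportedU; rewrite -mcoeff_neq0 in vf.
  have [b [s [Bb ->]]] := Bf _ vf.
  by exists (b *+ (p ^ e)), (s *+ (p ^ e)); rewrite mulrnDl; split => //; exists b.
rewrite {1}/monomial_ideal; apply: ideal_gen_sub; first exact: ideal_gen_is_ideal.
move=> _ [_ [b Bb <-] <-]; rewrite -mon_exp; apply: sub_ideal_gen.
by exists (mon b) => //; apply: sub_ideal_gen; exists b.
Qed.

End Supported.

Section NFold.
Variable K : nmodType.
Implicit Types A : set K.

Lemma nfoldD A m n x y : nfold A m x -> nfold A n y -> nfold A (m + n) (x + y).
Proof.
elim: m x => [|m IH] x; first by move=> ->; rewrite add0r.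
move=> [a Aa [x' Ax' <-]] Ay; rewrite addSn -addrA.
by exists a => //; exists (x' + y) => //; exact: IH.
Qed.

Lemma nfoldMn A n a : A a -> nfold A n (a *+ n).
Proof.
by move=> Aa; elim: n => [//|n IH]; exists a => //; exists (a *+ n); rewrite // mulrS.
Qed.

Lemma nfold_sum A m (a : 'I_m -> K) (n : 'I_m -> nat) : (forall j, A (a j)) ->
  nfold A (\sum_j n j) (\sum_j a j *+ n j).
Proof.
move=> Aa; apply: (big_ind2 (fun n x => nfold A n x)) => //.
  by move=> x1 x2 y1 y2; exact: nfoldD.
by move=> j _; exact: nfoldMn.
Qed.

Lemma nfold_split A n x : nfold A n x ->
  exists2 a : 'I_n -> K, forall i, A (a i) & x = \sum_i a i.
Proof.
elim: n x => [x ->|n IH x [b Ab [y /IH[a Aa ->] <-]]].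
  by exists (fun=> 0) => [[]//|]; rewrite big_ord0.
exists (fun i => if unlift ord0 i is Some j then a j else b).
  by move=> i; case: unliftP => [j _|_].
rewrite big_ord_recl unlift_none; congr (_ + _).
by apply: eq_bigr => i _; rewrite liftK.
Qed.

End NFold.

(** * The length of the quotient by a monomial ideal *)

Section CancellativeMonoid.
Variable K : nmodType.
Hypothesis addKK : forall u v s : K, u + s = v + s -> u = v.
Hypothesis torsfree : forall (s : K) n, s *+ n.+1 = 0 -> s = 0.

Lemma mulrn_inj (s : K) m n : s <> 0 -> s *+ m = s *+ n -> m = n.
Proof.
move=> s0.
suff le a b : s *+ a = s *+ b -> (a <= b)%N.
  by move=> smn; apply/eqP; rewrite eqn_leq !le.
rewrite leqNgt => sab; apply/negP => ba; apply: s0.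
apply: (@torsfree _ (a - b).-1); rewrite prednK ?subn_gt0//.
by apply: (@addKK _ _ (s *+ b)); rewrite add0r -mulrnDr subnK // ltnW.
Qed.

(** The points [u + n s] are pairwise distinct, hence they cannot all lie in the
    finite complement of [E]. *)
Lemma exists_multiple (E : set K) (u s : K) :
  finite_set (~` E) -> s <> 0 -> exists n, E (u + s *+ n).
Proof.
move=> finE s0; apply: contrapT => /forallNP nE.
apply: infinite_nat.
rewrite (_ : setT = (fun n => u + s *+ n) @^-1` (~` E)); last first.
  by apply/esym/seteqP; split => // n _; exact: nE.
apply: finite_preimage finE => n m _ _.
by rewrite [LHS]addrC [RHS]addrC => /addKK; exact: mulrn_inj.
Qed.

End CancellativeMonoid.

Section Colength.
Variables (R : realType) (k : fieldType) (K : nmodType).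
Implicit Types (f g : monoid_algebra k K) (E : set K).

Definition ideal_chain (A : comNzRingType) (J : set A) n (c : nat -> set A) :=
  [/\ forall i, (i <= n)%N -> is_ideal (c i), J `<=` c 0%N
    & forall i, (i < n)%N -> c i `<` c i.+1].

Lemma mcoeff_mkmalgU0M (c : k) f v :
  mcoeff v ((mkmalgU 0 c : monoid_algebra k K) * f) = c * mcoeff v f.
Proof.
rewrite -mcoeffZ malgZ_def /fgscale; congr (mcoeff v _).
rewrite [LHS](mamulw msuppU_le (fsubset_refl _)) big_seq_fset1.
by apply: eq_bigr => u _; rewrite mcoeffUU add0r.
Qed.

Lemma mcoeff_sum (I : Type) (r : seq I) (F : I -> monoid_algebra k K) v :
  mcoeff v (\sum_(i <- r) F i) = \sum_(i <- r) mcoeff v (F i).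
Proof. exact: (raddf_sum (@mcoeff K k v)). Qed.

Lemma ideal_chain_mono (A : comNzRingType) (J : set A) n c :
  ideal_chain J n c -> forall i j, (i <= j <= n)%N -> c i `<=` c j.
Proof.
move=> [_ _ cS] i j /andP[]; elim: j => [|j IH]; first by rewrite leqn0 => /eqP-> _ x.
rewrite leq_eqVlt => /orP[/eqP-> _ x //|ij] jn.
by move=> x /(IH ij (ltnW jn)) cx; case: (cS _ jn) => + _; apply.
Qed.

(** Choose [f i] in the [i+1]-st ideal but not in the [i]-th. If the chain were
    longer than [F], the restrictions of the [f i] to the exponents in [F] would be
    linearly dependent; the corresponding combination lies in [supported E], and its
    last nonzero term puts some [f i] into the [i]-th ideal. *)
Lemma ideal_chain_le E (F : {fset K}) n c :
  (forall v, ~ E v -> v \in F) ->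
  ideal_chain (supported E : set (monoid_algebra k K)) n c -> (n <= #|` F|)%N.
Proof.
move=> EF cc; rewrite leqNgt; apply/negP => Fn.
have [cI Ec cS] := cc.
have /choice[f fP] : forall i : nat, exists f, (i < n)%N -> c i.+1 f /\ ~ c i f.
  move=> i; have [/cS[_ /existsNP[f /not_implyP[cf ncf]]]|] := ltnP i n.
    by exists f.
  by exists 0.
pose A := \matrix_(i < n, j < #|` F|) mcoeff (nth 0 F j) (f i).
have /rowV0Pn[r /sub_kermxP rA r0] : kermx A != 0.
  by rewrite -mxrank_eq0 mxrank_ker -lt0n subn_gt0 (leq_ltn_trans (rank_leq_col A)).
have [i1 ri1] : exists i, r 0 i != 0.
  apply/existsP; apply: contraNT r0; rewrite negb_exists => /forallP r0.
  by apply/eqP/rowP => i; rewrite mxE; apply/eqP/negPn.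
pose i0 := [arg max_(i > i1 | (r 0 i != 0)%R) (i : nat)]%N.
have [ri0 i0max] : r 0 i0 != 0 /\ forall j, r 0 j != 0 -> (j <= i0)%N.
  by rewrite /i0; case: arg_maxnP.
(* [i0] is the last index of the relation, so the terms before it lie in [c i0]. *)
have [ci0 nci0] := fP i0 (ltn_ord i0).
have [c0 cD cM] := cI _ (ltnW (ltn_ord i0)).
pose a i : monoid_algebra k K := mkmalgU 0 (r 0 i).
have g0 : supported E (\sum_i a i * f i).
  move=> v; apply: contra_neqP => /EF vF.
  have jF : (index v F < #|` F|)%N by rewrite index_mem.
  have /rowP/(_ (Ordinal jF)) := rA.
  rewrite !mxE /= => rv; rewrite mcoeff_sum -{}[RHS]rv; apply: eq_bigr => i _.
  by rewrite mcoeff_mkmalgU0M mxE nth_index.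
have ci0g : c i0 (\sum_i a i * f i).
  by apply: (ideal_chain_mono cc _ (Ec _ g0)); rewrite leq0n ltnW.
have ci0s : c i0 (\sum_(i | i != i0) a i * f i).
  apply: (big_ind (c i0)) => // i ii0.
  have [ri|/i0max ji0] := eqVneq (r 0 i) 0.
    by rewrite /a ri monalgU0 mul0r.
  apply: cM; have [cfi _] := fP i (ltn_ord i).
  apply: (ideal_chain_mono cc _ cfi); rewrite (ltnW (ltn_ord i0)) andbT.
  by rewrite ltn_neqAle ji0 andbT.
apply: nci0.
have -> : f i0 = (mkmalgU 0 (r 0 i0)^-1 : monoid_algebra k K) * (a i0 * f i0).
  rewrite mulrA [_ * a i0]mamulUU addr0 mulVf //; exact/esym/mul1r.
apply: (cM).
have -> : a i0 * f i0 = \sum_i a i * f i + (- 1) * \sum_(i | i != i0) a i * f i.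
  by rewrite (bigD1 i0) //= mulN1r addrK.
by apply: cD => //; apply: cM.
Qed.

(** The chain adds the exponents of [F] one at a time. A point [v] of [F] that
    divides no other point of [F] can be added first: [v + K] then meets [F] in [v]
    alone. Such a point exists because divisibility is antisymmetric outside [E]. *)
Lemma exists_ideal_chain E (F : {fset K}) : upset E ->
  (forall u s s', ~ E u -> u + s + s' = u -> u + s = u) ->
  (forall v, v \in F -> ~ E v) ->
  exists c, ideal_chain (supported E : set (monoid_algebra k K)) #|` F| c.
Proof.
move: {2}#|` F| (erefl #|` F|) => n; elim: n E F => [|n IH] E F Fn upE aE FE.
  exists (fun=> supported E); rewrite Fn; split => // i _.
  exact: supported_is_ideal.
pose up (u : K) : {fset K} := [fset v in F | `[< exists s : K, v = (u + s)%R >]]%fset.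
have [v0 v0F] : exists v, v \in F.
  by apply/fset0Pn; rewrite -cardfs_gt0 Fn.
have [v [vF vmin]] : exists v, v \in F /\ forall u, u \in F -> (#|` up v| <= #|` up u|)%N.
  pose P m := `[< exists2 v, v \in F & #|` up v| = m >].
  have exP : exists m, P m by exists #|` up v0|; apply/asboolP; exists v0.
  case: (ex_minnP exP) => m /asboolP[v vF <-] mmin; exists v; split => // u uF.
  by apply: mmin; apply/asboolP; exists u.
have vtop u s : u \in F -> u = v + s -> u = v.
  move=> uF uvs; have : (#|` up v| <= #|` up u|)%N by exact: vmin.
  have uv : (up u `<=` up v)%fset.
    apply/fsubsetP => x; rewrite !inE => /andP[-> /asboolP[s' ->]] /=.
    by apply/asboolP; exists (s + s'); rewrite addrA -uvs.
  move=> le; have /eqP upE' : up u == up v by rewrite eqEfcard uv.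
  have : v \in up v by rewrite !inE vF /=; apply/asboolP; exists 0; rewrite addr0.
  rewrite -upE' !inE vF /= => /asboolP[s' vus'].
  by rewrite uvs; apply: (aE _ _ s'); [exact: FE|rewrite -uvs].
pose E' : set K := [set x | E x \/ exists s, x = v + s].
have upE'' : upset E'.
  move=> x s [Ex|[s' ->]]; first by left; apply: upE.
  by right; exists (s' + s); rewrite addrA.
have [] := IH E' (F `\ v)%fset.
- by rewrite (cardfsD1 v) vF in Fn; case: Fn.
- exact: upE''.
- by move=> u s s' nEu; apply: aE => Eu; apply: nEu; left.
- move=> u; rewrite !inE => /andP[uv uF] [|[s us]]; first exact: FE.
  by move/eqP: uv; apply; apply: vtop us.
move=> c; have -> : #|` (F `\ v)%fset| = n by move: Fn; rewrite (cardfsD1 v) vF => -[].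
move=> [cI Ec cS].
exists (fun i => if i is j.+1 then c j else supported E); rewrite Fn; split => //.
- by move=> [|i] //; [move=> _; exact: supported_is_ideal|exact: cI].
- move=> [_|i] /=; last exact: cS.
  split => [f Ef|].
    by apply: Ec => w /Ef; left.
  move=> cE; have : supported E (mon v : monoid_algebra k K).
    by apply: cE; apply: Ec; apply: supportedU; right; exists 0; rewrite addr0.
  by move=> /(_ v); rewrite mcoeffUU oner_eq0 => /(_ isT); exact: FE.
Qed.

Lemma colength_ge (J : set (monoid_algebra k K)) n c :
  ideal_chain J n c -> ((n%:R : R)%:E <= colength R J)%E.
Proof. by move=> Jc; apply: ereal_sup_ubound; exists n => //; exists c. Qed.

Lemma colength_pinfty (J : set (monoid_algebra k K)) :
  (forall n, exists m c, (n <= m)%N /\ ideal_chain J m c) -> colength R J = +oo%E.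
Proof.
move=> Jc; apply/eqyP => e e0.
have [m [c [nm /colength_ge]]] := Jc (Num.truncn e).+1.
apply: le_trans; rewrite lee_fin (le_trans (ltW (truncnS_gt e)))//.
by rewrite ler_nat.
Qed.

Hypothesis addKK : forall u v s : K, u + s = v + s -> u = v.
Hypothesis torsfree : forall (s : K) n, s *+ n.+1 = 0 -> s = 0.

(** A unit [s <> 0] of [K] would give infinitely many exponents [u + n s] outside
    [E]; so divisibility is antisymmetric there and both bounds on chains agree. *)
Lemma colength_supported E : upset E -> finite_set (~` E) ->
  colength R (supported E : set (monoid_algebra k K))
  = (#|` fset_set (~` E)|%:R)%:E.
Proof.
move=> upE finE; apply/eqP; rewrite eq_le; apply/andP; split.
  apply: ge_ereal_sup => _ [n [c cc] <-]; rewrite lee_fin ler_nat.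
  apply: (ideal_chain_le _ cc) => v nEv; rewrite in_fset_set // inE//.
suff [c] : exists c,
    ideal_chain (supported E : set (monoid_algebra k K)) #|` fset_set (~` E)| c.
  exact: colength_ge.
apply: exists_ideal_chain => //.
  move=> u s s' nEu uss; suff -> : s = 0 by rewrite addr0.
  have ss0 : s + s' = 0 by apply: (@addKK _ _ u); rewrite add0r addrC addrA.
  apply: contrapT => s0.
  have nE n : ~ E (u + s *+ n).
    move=> /(upE _ (s' *+ n)); rewrite -addrA -mulrnDl ss0 mul0rn addr0; exact: nEu.
  by have [n /nE] := exists_multiple addKK torsfree u finE s0.
by move=> v; rewrite in_fset_set // inE.
Qed.

End Colength.

Section FiniteColength.
Variables (R : realType) (k : fieldType) (K : nmodType).
Implicit Types (f g : monoid_algebra k K) (E : set K).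
Hypothesis addKK : forall u v s : K, u + s = v + s -> u = v.
Hypothesis torsfree : forall (s : K) n, s *+ n.+1 = 0 -> s = 0.

Section UnitChain.
Variables (E : set K) (u s s' : K).
Hypotheses (upE : upset E) (nEu : ~ E u) (ss' : s + s' = 0) (s0 : s <> 0).

(** The ideal generated by [supported E] and the binomial [x^(m s) - 1], where [s]
    is a unit of the monoid. *)
Definition binomial_ideal m : set (monoid_algebra k K) :=
  [set f | exists j r, supported E j /\ f = j + (mon (s *+ m) - 1) * r].

Lemma binomial_ideal_is_ideal m : is_ideal (binomial_ideal m).
Proof.
have [E0 ED EM] := supported_is_ideal k upE; split.
- by exists 0, 0; rewrite mulr0 addr0.
- move=> _ _ [j [r [Ej ->]]] [j' [r' [Ej' ->]]]; exists (j + j'), (r + r').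
  by split; [exact: ED|rewrite mulrDr addrACA].
- move=> x _ [j [r [Ej ->]]]; exists (x * j), (x * r); split; first exact: EM.
  by rewrite mulrDr mulrCA.
Qed.

Definition period_class m : set K :=
  [set v | exists a b, v + s *+ (m * a) = u + s *+ (m * b)].

(** The sum of the coefficients of [f] over the coset [u + Z m s]. It is invariant
    under multiplication by [x^(m s)], which separates the binomial ideals. *)
Definition class_sum m f : k :=
  mmap idfun (fun v => (v \in period_class m)%:R) f.

Lemma class_sumU m v c : class_sum m (mkmalgU v c) = c * (v \in period_class m)%:R.
Proof. exact: mmapU. Qed.

Lemma class_sumD m f g : class_sum m (f + g) = class_sum m f + class_sum m g.
Proof. exact: mmapD. Qed.

Lemma class_sumB m f g : class_sum m (f - g) = class_sum m f - class_sum m g.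
Proof. exact: mmapB. Qed.

Lemma class_sum_sum m (I : Type) (r : seq I) (F : I -> monoid_algebra k K) :
  class_sum m (\sum_(i <- r) F i) = \sum_(i <- r) class_sum m (F i).
Proof. exact: (raddf_sum (mmap idfun (fun v => (v \in period_class m)%:R))). Qed.

Lemma period_classD m v : (v + s *+ m \in period_class m) = (v \in period_class m).
Proof.
apply/idP/idP; rewrite !inE => -[a [b ab]].
  by exists a.+1, b; rewrite mulnS mulrnDr addrA.
by exists a, b.+1; rewrite mulnS mulrnDr addrAC ab -addrA [in RHS](addrC (s *+ m)).
Qed.

Lemma class_sum_binomial m f : class_sum m ((mon (s *+ m) - 1) * f) = 0.
Proof.
rewrite [f]sum_monomials mulr_sumr class_sum_sum big1 // => v _.
rewrite mulrBl mul1r [mon _ * _]mamulUU mul1r class_sumB !class_sumU.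
by rewrite addrC period_classD subrr.
Qed.

Lemma class_sum_supported m f : supported E f -> class_sum m f = 0.
Proof.
move=> Ef; rewrite [f]sum_monomials class_sum_sum big_seq big1 // => v.
rewrite -mcoeff_neq0 => /Ef Ev; rewrite class_sumU.
case: (boolP (v \in _)) => [|_]; last by rewrite mulr0.
rewrite inE => -[a [b ab]]; exfalso; apply: nEu.
rewrite -[u]addr0 -(mul0rn K (m * b)) -ss' mulrnDl addrA -ab -addrA.
exact: upE.
Qed.

(** The inclusion is [x^(2w) - 1 = (x^w - 1) (x^w + 1)]. It is strict because the
    class sum modulo [2 m s] vanishes on the smaller ideal, while it takes the value
    [-1] on [x^u (x^(m s) - 1)]. *)
Lemma binomial_ideal_proper m : (0 < m)%N ->
  binomial_ideal (m * 2) `<` binomial_ideal m.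
Proof.
move=> m0; split.
  move=> _ [j [r [Ej ->]]]; exists j, ((mon (s *+ m) + 1) * r); split => //.
  by rewrite mulrA -subr_sqr expr1n expr2 -monD -mulr2n -mulrnA.
move=> sub.
have [j [r [Ej e]]] : binomial_ideal (m * 2) (mon u * (mon (s *+ m) - 1)).
  by apply: sub; exists 0, (mon u); rewrite add0r mulrC; split => //; exact: supported0.
have := congr1 (class_sum (m * 2)) e.
rewrite class_sumD class_sum_binomial (class_sum_supported _ Ej) addr0.
rewrite mulrBr mulr1 -monD class_sumB !class_sumU !mul1r.
have -> : u \in period_class (m * 2) by rewrite inE; exists 0%N, 0%N.
have -> : u + s *+ m \in period_class (m * 2) = false.
  apply/negbTE; rewrite notin_setE => -[a [b]].
  rewrite -addrA -mulrnDr [LHS]addrC [RHS]addrC => /addKK /(mulrn_inj addKK torsfree s0).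
  rewrite -mulnA -[X in (X + _)%N]muln1 -mulnA -mulnDr mulnA.
  move/eqP; rewrite -mulnA eqn_pmul2l // => /eqP/(congr1 odd).
  by rewrite oddD !oddM.
by move/eqP; rewrite sub0r oppr_eq0 oner_eq0.
Qed.

Lemma binomial_ideal_chain n :
  ideal_chain (supported E) n (fun i => binomial_ideal (2 ^ (n - i))).
Proof.
split => [i _|f Ef|i lin]; first exact: binomial_ideal_is_ideal.
  by exists f, 0; rewrite mulr0 addr0.
rewrite (_ : (n - i = (n - i.+1).+1)%N); last by rewrite subnSK.
by rewrite expnSr; apply: binomial_ideal_proper; rewrite expn_gt0.
Qed.

End UnitChain.

(** If the complement of [E] is infinite there are arbitrarily long chains: of
    binomial ideals when some exponent outside [E] can be translated by a nonzero unit
    (the monoid is then not pointed), and of monomial ideals otherwise. *)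
Lemma finite_compl_of_colength E : upset E ->
  (colength R (supported E : set (monoid_algebra k K)) < +oo)%E ->
  finite_set (~` E).
Proof.
move=> upE fincol; apply: contrapT => infE.
suff : colength R (supported E : set (monoid_algebra k K)) = +oo%E.
  by move=> e; rewrite e ltxx in fincol.
apply: colength_pinfty => n.
have [[u [s [s' [nEu ss' s0]]]]|noU] :=
    pselect (exists u s s' : K, [/\ ~ E u, s + s' = 0 & s <> 0]).
  exists n, (fun i => binomial_ideal E s (2 ^ (n - i))); split => //.
  exact: (binomial_ideal_chain upE nEu ss' s0).
have [F FE Fn] := infinite_set_fset n infE.
have [| |c cc] := @exists_ideal_chain k K E F upE.
- move=> u s s' nEu uss; have [->|/eqP s0] := eqVneq s 0; first by rewrite addr0.
  exfalso; apply: noU; exists u, s, s'; split => //.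
  by apply: (@addKK _ _ u); rewrite add0r addrC addrA.
- by move=> v vF; exact: FE.
- by exists #|` F|, c.
Qed.

End FiniteColength.

(** * Counting lattice points *)

Section NCard.
Implicit Types T U : choiceType.

Definition ncard T (A : set T) : nat := #|` fset_set A|.

Lemma ncard_sub T (A B : set T) : finite_set B -> A `<=` B -> (ncard A <= ncard B)%N.
Proof.
move=> finB AB; apply: fsubset_leq_card; rewrite -fset_set_sub //.
exact: sub_finite_set finB.
Qed.

Lemma ncardU_le T (A B : set T) : finite_set A -> finite_set B ->
  (ncard (A `|` B) <= ncard A + ncard B)%N.
Proof. by move=> finA finB; rewrite /ncard fset_setU // leq_card_fsetU. Qed.

Lemma ncard_cover T (I : eqType) (r : seq I) (A : set T) (B : I -> set T) :
  (forall i, finite_set (B i)) ->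
  (forall x, A x -> exists2 i, i \in r & B i x) ->
  (ncard A <= \sum_(i <- r) ncard (B i))%N.
Proof.
move=> finB; elim: r A => [|i r IH] A AB.
  rewrite (_ : A = set0) ?/ncard ?fset_set0 ?cardfs0 //.
  by apply/seteqP; split => // x /AB[].
have finBr : finite_set [set x | exists2 j, j \in r & B j x].
  apply: sub_finite_set (bigcup_finite (finite_seq r) (fun i _ => finB i)).
  by move=> x [j jr Bx]; exists j.
rewrite big_cons; apply: (@leq_trans (ncard (B i `|` [set x | exists2 j, j \in r & B j x]))).
  apply: ncard_sub; first by rewrite finite_setU.
  by move=> x /AB[j]; rewrite inE => /predU1P[-> ?|jr Bx]; [left|right; exists j].
by apply: leq_trans (ncardU_le _ _) _ => //; rewrite leq_add2l IH.
Qed.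

Lemma finite_inj T U (f : T -> U) (A : set T) (B : set U) :
  finite_set B -> {in A &, injective f} -> (forall x, A x -> B (f x)) ->
  finite_set A.
Proof.
move=> finB finj AB; pose g x := if x \in A then Some (f x) else None.
apply: sub_finite_set (finite_preimage (f := g) _ (finite_image Some finB)).
  by move=> x Ax /=; rewrite /g mem_set //; exists (f x) => //; exact: AB.
move=> x y; rewrite !inE /g /=.
case: (boolP (x \in A)) => xA [b Bb] // _; case: (boolP (y \in A)) => yA // [b' Bb'] // _ [].
exact: finj.
Qed.

Lemma ncard_inj T U (f : T -> U) (A : set T) (B : set U) :
  finite_set B -> {in A &, injective f} -> (forall x, A x -> B (f x)) ->
  (ncard A <= ncard B)%N.
Proof.
move=> finB finj AB; have finA := finite_inj finB finj AB.
have inA x : (x \in fset_set A) = (x \in A) by rewrite in_fset_set.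
have cA : #|` [fset f x | x in fset_set A]%fset| = #|` fset_set A|.
  by rewrite card_in_imfset // => x y /=; rewrite !inA; exact: finj.
rewrite /ncard -cA.
apply: fsubset_leq_card; apply/fsubsetP => _ /imfsetP[x /= xA ->].
by rewrite in_fset_set // inE; apply: AB; rewrite inA inE in xA.
Qed.

Lemma ncard_image_fin (F : finType) T (g : F -> T) (A : set T) :
  (forall x, A x -> exists y, x = g y) -> finite_set A /\ (ncard A <= #|F|)%N.
Proof.
move=> Ag; have finA : finite_set A.
  apply: (@sub_finite_set _ _ [set` [fset g y | y : F]%fset]) => // x /Ag[y ->] /=.
  by apply/imfsetP; exists y.
split => //; have le : (#|` [fset g y | y : F]%fset| <= #|F|)%N.
  apply: leq_trans (leq_imfset_card _ _ _) _; rewrite cardE.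
  by apply: uniq_leq_size => [|y _]; [exact: enum_finmem_uniq|rewrite mem_enum].
apply: leq_trans le; apply: fsubset_leq_card; apply/fsubsetP => x.
rewrite in_fset_set // inE => /Ag[y ->].
by apply/imfsetP; exists y.
Qed.

End NCard.

Section LatticeBox.
Variables (R : archiRealDomainType) (d : nat).

Definition lattice_box (l u : 'I_d -> R) : set 'rV[int]_d :=
  [set z | forall i, l i <= (z 0 i)%:~R <= u i].

Lemma lattice_box_count (l u : 'I_d -> R) : (forall i, l i <= u i) ->
  finite_set (lattice_box l u) /\
  (ncard (lattice_box l u))%:R <= \prod_i (u i - l i + 1).
Proof.
move=> lu; pose n i := (Num.truncn (u i - l i)).+1.
pose g (f : {dffun forall i : 'I_d, 'I_(n i)}) : 'rV[int]_d :=
  \row_i (Num.ceil (l i) + (f i : nat)%:Z).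
have [|fin le] := @ncard_image_fin _ _ g (lattice_box l u).
  move=> z zlu.
  have zn i : (`|z 0%R i - Num.ceil (l i)|%N < n i)%N.
    have /andP[lz zu] := zlu i.
    rewrite ltnS truncn_ge_nat ?subr_ge0 // natr_absz ger0_norm ?subr_ge0 ?ceil_le_int//.
    rewrite rmorphB /=; apply: lerB => //; exact: ceil_ge.
  exists [ffun i => Ordinal (zn i)]; apply/rowP => i; rewrite mxE ffunE /=.
  have /andP[lz zu] := zlu i.
  by rewrite gez0_abs ?subr_ge0 ?ceil_le_int// subrKC.
split => //; apply: le_trans (_ : (#|{dffun forall i : 'I_d, 'I_(n i)}|)%:R <= _).
  by rewrite ler_nat.
rewrite card_dep_ffun foldrE big_map big_enum /= natr_prod.
apply: ler_prod => i _; rewrite ?ler0n ?card_ord /n -natr1 lerD2r.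
by rewrite /= truncn_le subr_ge0 lu.
Qed.

End LatticeBox.

Section BoundaryLayer.
Variable d : nat.
Implicit Types (w z : 'rV[int]_d.+1).

Definition cube (L : nat) : set 'rV[int]_d.+1 :=
  [set z | forall i, (`|z 0%R i| <= L)%N].

Lemma absz_le_itv (R : realDomainType) (m : int) (L : nat) :
  (`|m| <= L)%N = (- L%:R <= (m%:~R : R) <= L%:R).
Proof. by rewrite -ler_norml -intr_norm -(ler_nat R) natr_absz. Qed.

Lemma cubeE L : cube L = lattice_box (fun=> - L%:R : rat) (fun=> L%:R).
Proof.
by apply/seteqP; split => z zL i; have := zL i; rewrite (absz_le_itv rat).
Qed.

Lemma finite_cube L : finite_set (cube L).
Proof.
by rewrite cubeE; apply: (lattice_box_count _).1 => i; rewrite ge0_cp ?ler0n.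
Qed.

(** A set stable under translation by [w] meets each line [z + Z w] in an up-set, so
    at most one point of the line is in the set while its predecessor is not. A cube
    of side [L] meets only [O(L^(dim - 1))] such lines: each of them has a point of size
    [O(L)] whose [j]-th coordinate lies between [0] and [|w_j|], where [w_j <> 0]. *)
Lemma boundary_layer_count w : exists c : nat,
  forall (X : set 'rV[int]_d.+1) (L : nat), (forall z, X z -> X (z + w)) ->
    (ncard [set z | [/\ cube L z, X z & ~ X (z - w)%R]] <= c * L.+1 ^ d)%N.
Proof.
have [w0|/eqP w0] := eqVneq w 0.
  exists 0%N => X L _; rewrite (_ : [set z | _] = set0) ?/ncard ?fset_set0 //.
  by apply/seteqP; split => // z [_]; rewrite w0 subr0.
have [j wj] : exists j, w 0 j != 0.
  apply: contrapT => /forallNP wj; apply: w0; apply/rowP => j; rewrite mxE.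
  by apply/eqP; apply: contrapT => /negP; exact: wj.
pose W := (\sum_i `|w 0%R i|)%N.
have wW i : (`|w 0%R i| <= W)%N by rewrite /W (bigD1 i) //= leq_addr.
exists (W * (2 * (1 + W)) ^ d)%N => X L Xw.
pose N := (L + L * W)%N.
pose l i : rat := if i == j then 0 else - N%:R.
pose u i : rat := if i == j then (`|w 0%R j|.-1)%:R else N%:R.
have lu i : l i <= u i.
  by rewrite /l /u; case: ifP => _; rewrite ?ler0n // ge0_cp ?ler0n.
have [finB cardB] := lattice_box_count lu.
(* The representative of the line through [z] whose [j]-th coordinate is reduced. *)
pose f z := z - (z 0%R j %/ w 0%R j)%Z *: w.
have wj0 : (0 < `|w 0%R j|)%N by rewrite absz_gt0.
apply: (@leq_trans (ncard (lattice_box l u))).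
  apply: (ncard_inj (f := f)) => //; last first.
    move=> z [zL _ _] i; rewrite /f !mxE /l /u.
    have [->|ij] := eqVneq i j.
      rewrite -[z 0 j - _]/(z 0%R j %% w 0%R j)%Z.
      rewrite -[0]/(0%:~R : rat) ler_int modz_ge0 //=.
      rewrite [X in _ <= X]pmulrn ler_int -ltzD1 addrC -intS prednK //.
      by rewrite abszE ltz_mod.
    rewrite -absz_le_itv -lez_nat abszE.
    apply: le_trans (ler_normB _ _) _; rewrite /N PoszD lerD //.
      by rewrite -abszE lez_nat.
    rewrite normrM -!abszE -PoszM lez_nat leq_mul //.
    apply: leq_trans (zL j); exact: lez_div.
  have key z z' : X z' -> ~ X (z - w) -> forall n : nat, z = z' + w *+ n.+1 -> False.
    move=> Xz' nXz n zE; apply: nXz; rewrite zE mulrSr addrA addrK.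
    by elim: n {zE} => [|n IH]; rewrite ?addr0 // mulrSr addrA; apply: Xw.
  move=> z z'; rewrite !inE => -[_ Xz nXz] [_ Xz' nXz'] fzz'.
  pose k := (z 0%R j %/ w 0%R j)%Z - (z' 0%R j %/ w 0%R j)%Z.
  have zk : z = z' + k *: w.
    rewrite /k scalerBl; move/eqP: fzz'; rewrite /f subr_eq => /eqP {1}->.
    by rewrite addrAC -addrA.
  case: k zk => [[|n]|n] zk; first by rewrite zk scale0r addr0.
    exfalso; apply: (key z z' Xz' nXz n); rewrite zk; congr (_ + _).
    by rewrite -scaler_nat; congr (_ *: _); rewrite natz.
  exfalso; apply: (key z' z Xz nXz' n); rewrite zk NegzE scaleNr -addrA -scaler_nat natz.
  by rewrite addNr addr0.
rewrite -(ler_nat rat); apply: le_trans cardB _.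
rewrite (bigD1 j) //= /l /u eqxx subr0 natr1 prednK //.
rewrite (eq_bigr (fun=> (2 * N + 1)%:R)); last first.
  by move=> i /negPf->; rewrite opprK natrD mul2n -addnn natrD.
rewrite prodr_const cardC1 card_ord /= -natrX -natrM ler_nat.
rewrite -mulnA leq_mul // -expnMn.
suff le : (2 * N + 1 <= 2 * (1 + W) * L.+1)%N.
  by case: (d) => // d'; rewrite leq_exp2r.
by rewrite /N; clearbody W; clear; nia.
Qed.

End BoundaryLayer.

(** * Lattice points and volume *)

Section LatticeUpperBound.
Variables (R : realType) (d : nat).
Implicit Types (K : set 'rV[R]_d) (z : 'rV[int]_d).

Definition rvec z : 'rV[R]_d := map_mx (fun x : int => x%:~R) z.

(** The points of [K] in the lattice [(1/m) Z^d], scaled up by [m]. *)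
Definition lattice_points K (m : nat) : set 'rV[int]_d :=
  [set z | K (m%:R^-1 *: rvec z)].

Definition closed_box (a b : 'rV[R]_d) : set 'rV[R]_d :=
  [set x | forall i, a 0 i <= x 0 i <= b 0 i].

Lemma prod_addr_le (I : Type) (r : seq I) (l : I -> R) : (forall i, 0 <= l i) ->
  exists2 C, 0 <= C & forall x, 0 <= x <= 1 ->
    \prod_(i <- r) (l i + x) <= \prod_(i <- r) l i + C * x.
Proof.
move=> l0; elim: r => [|i r [C C0 IH]].
  by exists 0 => // x _; rewrite !big_nil mul0r addr0.
have P0 : 0 <= \prod_(i <- r) l i by apply: prodr_ge0.
exists (\prod_(i <- r) l i + C * l i + C); first by have := l0 i; nra.
move=> x /[dup] x01 /IH{}IH; rewrite !big_cons.
have li := l0 i; case/andP: x01 => x0 x1.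
have /le_trans : (l i + x) * \prod_(j <- r) (l j + x) <=
  (l i + x) * (\prod_(j <- r) l j + C * x) by rewrite ler_wpM2l // addr_ge0.
apply; move: P0; set P := \prod_(j <- r) l j => P0.
have : C * x * x <= C * x by rewrite ler_piMr // mulr_ge0.
nra.
Qed.

(** The factor 3 leaves room for twice the margin added around a box and for the
    term [1/m] in the count of lattice points of a box. *)
Lemma prod_enlarge (l : 'I_d -> R) e : (forall i, 0 <= l i) -> 0 < e ->
  exists2 x, 0 < x & \prod_i (l i + 3 * x) <= \prod_i l i + e.
Proof.
move=> l0 e0; have [C C0 PC] := prod_addr_le (index_enum 'I_d) l0.
have x1 : 0 < Num.min 1 (e / (C + 1)) by rewrite lt_min ltr01 divr_gt0 // ltr_wpDl.
set x := Num.min _ _ in x1.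
have xle1 : x <= 1 by rewrite ge_min lexx.
exists (x / 3); first by rewrite divr_gt0.
rewrite mulrC divfK ?pnatr_eq0//; apply: le_trans (PC x _) _; first by rewrite ltW.
rewrite lerD2l; apply: (@le_trans _ _ ((C + 1) * x)).
  by rewrite ler_wpM2r ?ltW // ltrDl.
by rewrite mulrC -ler_pdivlMr ?ge_min ?lexx ?orbT // ltr_wpDl.
Qed.

Lemma closed_box_interior (a b : 'rV[R]_d) e : 0 < e ->
  closed_box a b `<=` (closed_box (a - const_mx e) (b + const_mx e))°.
Proof.
move=> e0 x xab; rewrite /interior -nbhs_ballE; exists e => //= y [_ xy] i.
have /andP[ax xb] := xab i; have := xy 0 i; rewrite /ball /= ltr_distl => /andP[].
by rewrite !mxE => *; apply/andP; split; lra.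
Qed.

(** By compactness finitely many slightly enlarged boxes suffice, and a box with
    sides [l i] has at most [prod (m * l i + 1)] points of [(1/m) Z^d]. This bounds
    the density of lattice points by the total volume of any countable cover. *)
Lemma lattice_points_le_cover K (ab : (nat -> 'rV[R]_d) * (nat -> 'rV[R]_d)) v e :
  compact K -> (forall n i, ab.1 n 0 i <= ab.2 n 0 i) ->
  K `<=` \bigcup_n closed_box (ab.1 n) (ab.2 n) ->
  (\sum_(0 <= n <oo) (\prod_(i < d) (ab.2 n 0 i - ab.1 n 0 i))%:E <= v%:E)%E ->
  0 < e ->
  exists m0, forall m, (m0 <= m)%N -> (0 < m)%N ->
    (ncard (lattice_points K m))%:R <= m%:R ^+ d * (v + e).
Proof.
move: ab => [a b] /= cK ab Kab sumv e0.
pose P n := \prod_(i < d) (b n 0 i - a n 0 i).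
have P0 n : 0 <= P n by apply: prodr_ge0 => i _; rewrite subr_ge0.
have /choice[x xP] : forall n, exists x, 0 < x /\
    \prod_(i < d) (b n 0 i - a n 0 i + 3 * x) <= P n + e / 2 ^+ n.+1.
  move=> n; have [||x x0 xP] := @prod_enlarge (fun i => b n 0 i - a n 0 i) (e / 2 ^+ n.+1).
  - by move=> i; rewrite subr_ge0.
  - by rewrite divr_gt0 // exprn_gt0.
  by exists x.
pose U n := closed_box (a n - const_mx (x n)) (b n + const_mx (x n)).
move: cK; rewrite compact_cover => /(_ nat setT (fun n => (U n)°)) [].
- by move=> n _; exact: open_interior.
- move=> y /Kab[n _ yn]; exists n => //.
  by apply: closed_box_interior yn; case: (xP n).
move=> D _ KD.
have [m1 m1P] : exists m1 : nat, forall m, (m1 <= m)%N ->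
    forall n, n \in (enum_fset D : seq nat) -> m%:R^-1 <= x n.
  elim: (enum_fset D : seq nat) => [|n r [m1 IH]]; first by exists 0%N.
  exists (maxn m1 (Num.truncn (x n)^-1).+1) => m; rewrite geq_max => /andP[mm1 mx] n'.
  rewrite inE => /predU1P[->|]; last exact: IH.
  have [x0 _] := xP n.
  rewrite -[x n]invrK lef_pV2 ?posrE ?invr_gt0 ?ltr0n //; last exact: leq_trans mx.
  by apply: le_trans (ltW (truncnS_gt _)) _; rewrite ler_nat.
exists m1 => m m1m m0.
have mR0 : 0 < m%:R :> R by rewrite ltr0n.
pose l n i := m%:R * (a n 0 i - x n); pose u n i := m%:R * (b n 0 i + x n).
have lu n i : l n i <= u n i.
  rewrite ler_pM2l // lerD ?ab //; have [x0 _] := xP n.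
  by rewrite ge0_cp // ltW.
have cover : forall z, lattice_points K m z ->
    exists2 n, n \in enum_fset D & lattice_box (l n) (u n) z.
  move=> z /KD[n /= nD]; move/interior_subset => zU; exists n => // i.
  have /andP[] := zU i; rewrite !mxE /l /u => za zb.
  by apply/andP; split; [rewrite -ler_pdivlMl | rewrite -ler_pdivrMl].
have fin n : finite_set (lattice_box (l n) (u n)) by case: (lattice_box_count (lu n)).
have := ncard_cover fin cover; rewrite -(ler_nat R) => /le_trans; apply.
rewrite natr_sum; apply: (@le_trans _ _ (\sum_(n <- D) m%:R ^+ d * (P n + e / 2 ^+ n.+1))).
  rewrite big_seq [leRHS]big_seq; apply: ler_sum => n nD.
  apply: le_trans (lattice_box_count (lu n)).2 _.
  have [x0 xn] := xP n.
  apply: (@le_trans _ _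
    (m%:R ^+ d * \prod_(i < d) (b n 0 i - a n 0 i + 3 * x n))); last first.
    by rewrite ler_wpM2l // exprn_ge0 // ltW.
  rewrite -[X in m%:R ^+ X](card_ord d) -prodr_const -big_split /=.
  apply: ler_prod => i _; apply/andP; split.
    by rewrite addr_ge0 // subr_ge0 lu.
  have : 1 <= m%:R * x n by rewrite -ler_pdivrMl // mulr1 m1P.
  rewrite /l /u; move: (m%:R) (a n 0 i) (b n 0 i) => *; nra.
rewrite -mulr_sumr ler_pM2l ?exprn_gt0 //.
(* All the indices of the finite subcover are below [N]. *)
pose N := (\max_(n <- D) n).+1.
apply: (@le_trans _ _ (\sum_(0 <= n < N) (P n + e / 2 ^+ n.+1))).
  rewrite (perm_big [seq n <- index_iota 0 N | n \in enum_fset D]); last first.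
    apply: uniq_perm => [||n]; first exact: fset_uniq.
      exact: filter_uniq (iota_uniq _ _).
    rewrite mem_filter mem_index_iota andb_idr // => nD; rewrite ltnS.
    by rewrite (big_rem n) //= leq_maxl.
  rewrite big_filter big_mkcond; apply: ler_sum => n _; case: ifP => // _.
  by rewrite addr_ge0 // divr_ge0 ?exprn_ge0 ?(ltW e0).
rewrite big_split /=; apply: lerD.
  rewrite -lee_fin -sumEFin; apply: le_trans sumv.
  by apply: nneseries_lim_ge => n _ _; rewrite lee_fin; exact: P0.
rewrite -mulr_sumr -[leRHS]mulr1 ler_pM2l //.
have -> : \sum_(0 <= i < N) (2 ^+ i.+1)^-1 = 1 - (2 ^+ N)^-1 :> R.
  elim: (N) => [|j IH]; first by rewrite big_geq // expr0 invr1 subrr.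
  rewrite big_nat_recr //= IH [in RHS]exprS exprS; field.
  by rewrite expf_neq0.
by rewrite gerBl invr_ge0 exprn_ge0.
Qed.

End LatticeUpperBound.

Section CellCover.
Variables (R : realType) (d : nat).
Implicit Types (X : set 'rV[R]_d.+1) (z : 'rV[int]_d.+1).

Lemma vol_ge0 X : (0 <= vol X)%E.
Proof.
apply: le_ereal_inf_tmp => _ [[a b] /= [ab _] <-].
by apply: nneseries_ge0 => n _ _; rewrite lee_fin prodr_ge0 // => i _; rewrite subr_ge0.
Qed.

(** Cubes of side [1/q] at the given lattice points, padded by boxes reduced to a
    point, form one of the covers that define the volume. *)
Lemma vol_le_cells X (s : seq 'rV[int]_d.+1) (q : nat) : (0 < q)%N ->
  (forall x, X x -> exists2 z, z \in s &
     forall i, (z 0 i)%:~R <= q%:R * x 0 i <= (z 0 i)%:~R + 1) ->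
  (vol X <= ((size s)%:R / q%:R ^+ d.+1)%:E)%E.
Proof.
move=> q0 Xs; have qR : 0 < q%:R :> R by rewrite ltr0n.
pose a n : 'rV[R]_d.+1 := if (n < size s)%N then q%:R^-1 *: rvec R (nth 0 s n) else 0.
pose b n : 'rV[R]_d.+1 :=
  if (n < size s)%N then q%:R^-1 *: (rvec R (nth 0 s n) + const_mx 1) else 0.
have ab n : \prod_(i < d.+1) (b n 0 i - a n 0 i) =
    if (n < size s)%N then q%:R^-1 ^+ d.+1 else 0.
  rewrite /a /b; case: ifP => _.
    rewrite -[X in _ ^+ X]card_ord -prodr_const; apply: eq_bigr => i _.
    by rewrite !mxE -mulrBr addrAC subrr add0r mulr1.
  by rewrite big_ord_recl !mxE subrr mul0r.
apply: (@le_trans _ _ (\sum_(0 <= n <oo) (\prod_(i < d.+1) (b n 0 i - a n 0 i))%:E)%E).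
  apply: ereal_inf_lbound; exists (a, b) => //=; split.
    move=> n i; rewrite /a /b; case: ifP => // _.
    by rewrite !mxE ler_pM2l ?invr_gt0 // lerDl.
  move=> x /Xs[z zs zx]; exists (index z s) => // i.
  rewrite /a /b /= index_mem zs nth_index // !mxE.
  by rewrite ler_pdivrMl // ler_pdivlMl.
apply: lime_le.
  apply: is_cvg_nneseries => n _ _; rewrite lee_fin ab.
  by case: ifP; rewrite // exprn_ge0 // invr_ge0 ltW.
apply: nearW => k; rewrite sumEFin lee_fin.
have -> : \sum_(0 <= n < k) \prod_(i < d.+1) (b n 0 i - a n 0 i) =
    (minn k (size s))%:R * q%:R^-1 ^+ d.+1.
  elim: k => [|k IH]; first by rewrite big_geq // min0n mul0r.
  rewrite big_nat_recr //= IH ab; case: ifP => [|/negbT]; rewrite -?leqNgt => ks.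
    by rewrite (minn_idPl (ltnW ks)) (minn_idPl ks) -[in RHS]natr1 mulrDl mul1r.
  by rewrite addr0 !(minn_idPr _) // leqW.
by rewrite exprVn ler_pM2r ?invr_gt0 ?exprn_gt0 // ler_nat geq_minr.
Qed.

End CellCover.

(** Here [sigma] is a convex cone with a lattice point [w] deep in its interior and
    [Q] is stable under translation by [sigma]. The set [T q] is squeezed between
    [(w + sigma) \ q Q] and [sigma \ (w + q Q)]; as [w] is fixed and [q] grows, both
    bounds differ from [q (sigma \ Q)] only along boundary layers. *)
Section RegionContent.
Variables (R : realType) (d : nat).
Variables (sigma Q : set 'rV[R]_d.+1) (w : 'rV[int]_d.+1) (L : nat).
Notation rv := (@rvec R d.+1).
Implicit Types z : 'rV[int]_d.+1.
Hypothesis sigmaD : forall x y, sigma x -> sigma y -> sigma (x + y).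
Hypothesis sigmaZ : forall c x, 0 <= c -> sigma x -> sigma (c *: x).
Hypothesis QD : forall x y, Q x -> sigma y -> Q (x + y).
Hypothesis w_interior : forall y : 'rV[R]_d.+1,
  (forall i, `|y 0 i| <= 2) -> sigma (rv w + y).
Hypothesis P_bounded : forall x : 'rV[R]_d.+1,
  (sigma `\` Q) x -> forall i, `|x 0 i| <= L%:R.

Let P := sigma `\` Q.

Lemma rvecD z z' : rv (z + z') = rv z + rv z'.
Proof. by apply/rowP => i; rewrite !mxE rmorphD. Qed.

Lemma rvecN z : rv (- z) = - rv z.
Proof. by apply/rowP => i; rewrite !mxE rmorphN. Qed.

Lemma rvecB z z' : rv (z - z') = rv z - rv z'.
Proof. by rewrite rvecD rvecN. Qed.

Lemma sigma_w : sigma (rv w).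
Proof. by rewrite -[rv w]addr0; apply: w_interior => i; rewrite mxE normr0 ler0n. Qed.

Lemma closure_region_bounded x : closure P x -> forall i, `|x 0 i| <= L%:R.
Proof.
move=> Px i; rewrite leNgt; apply/negP => Lx.
have e0 : 0 < `|x 0 i| - L%:R by rewrite subr_gt0.
have /Px[y [Py [_ xy]]] : nbhs x (ball x (`|x 0 i| - L%:R)) by exact: nbhsx_ballx.
have := xy 0 i; rewrite /ball /= => xyi.
have := ler_distD 0 (x 0 i) (y 0 i); have := lerB_dist (x 0 i) (y 0 i).
have := P_bounded Py i; lra.
Qed.

Lemma compact_closure_region : compact (closure P).
Proof.
apply: bounded_closed_compact; last exact: closed_closure.
exists L%:R; split; first exact: num_real.
move=> x Lx y Py. rewrite /= [leLHS]/Num.norm /= mx_normrE.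
apply/bigmax_leP; split; first by rewrite (le_trans _ (ltW Lx)).
by move=> [i j] _ /=; rewrite ord1 (le_trans (closure_region_bounded Py j)) // ltW.
Qed.

Lemma finite_lattice_points q : (0 < q)%N -> finite_set (lattice_points (closure P) q).
Proof.
move=> q0; apply: sub_finite_set (@finite_cube d (L * q)) => z Pz i.
have := closure_region_bounded Pz i; rewrite !mxE normrM ger0_norm ?invr_ge0 //.
rewrite ler_pdivrMl ?ltr0n // -intr_norm -natr_absz -natrM ler_nat.
by rewrite mulnC.
Qed.

(** Lower corners of unit cubes that cover [q * closure P]. *)
Let cells q : set 'rV[int]_d.+1 := [set z | [/\ cube ((L + 3) * q) z,
  sigma (rv (z + w)) & ~ Q (q%:R^-1 *: rv (z - w))]].

Lemma finite_cells q : finite_set (cells q).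
Proof. by apply: sub_finite_set (@finite_cube d ((L + 3) * q)) => z []. Qed.

(** If [y] in [P] is close to a point of the cube at [z / q], then [q y] and [z]
    differ by at most 2 in each coordinate; since [w] absorbs such a difference,
    [z + w] is in [sigma] and [z - w] is not in [q Q]. *)
Lemma vol_le_ncard_cells q : (0 < q)%N ->
  (vol (closure P) <= ((ncard (cells q))%:R / q%:R ^+ d.+1)%:E)%E.
Proof.
move=> q0; have qR : 0 < q%:R :> R by rewrite ltr0n.
apply: vol_le_cells => // x Px.
have [z zx] : exists z, forall i, (z 0 i)%:~R <= q%:R * x 0 i < (z 0 i)%:~R + 1.
  exists (\row_i Num.floor (q%:R * x 0 i)) => i.
  by rewrite mxE floor_le_tmp -[X in _ + X]/(1%:~R) -intrD floorD1_gt.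
exists z; last by move=> i; have /andP[-> /ltW] := zx i.
have /Px[y [Py [_ xy]]] : nbhs x (ball x (q%:R^-1 : R)).
  by apply: nbhsx_ballx; rewrite invr_gt0.
have qyz i : `|q%:R * y 0 i - (z 0 i)%:~R| <= 2.
  have := xy 0 i; rewrite /ball /= -(ltr_pM2l qR) mulfV ?gt_eqF //.
  rewrite -{1}(gtr0_norm qR) -normrM mulrBr.
  have := zx i; rewrite !ltr_norml ler_norml => /andP[? ?] /andP[? ?].
  by apply/andP; split; lra.
have [sy nQy] := Py.
rewrite in_fset_set ?inE; last exact: finite_cells.
split.
- move=> i; have := qyz i; have := P_bounded Py i.
  rewrite (absz_le_itv R) !ler_norml => /andP[yl yu] /andP[zl zu].
  have q1 : 1 <= q%:R :> R by rewrite ler1n.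
  have : q%:R * - L%:R <= q%:R * y 0 i by rewrite ler_pM2l.
  have : q%:R * y 0 i <= q%:R * L%:R by rewrite ler_pM2l.
  rewrite natrM natrD; move: (q%:R) (L%:R) q1 zl zu => *; apply/andP; split; nra.
- have -> : rv (z + w) = q%:R *: y + (rv w + (rv z - q%:R *: y)).
    by rewrite rvecD addrCA subrKC addrC.
  apply: sigmaD; first by apply: sigmaZ => //; exact: ltW.
  by apply: w_interior => i; rewrite !mxE distrC.
- move=> Qz; apply: nQy.
  have -> : y = q%:R^-1 *: rv (z - w) + q%:R^-1 *: (rv w + (q%:R *: y - rv z)).
    by rewrite -scalerDr rvecB addrA subrK subrKC scalerA mulVf ?scale1r ?gt_eqF.
  apply: QD => //; apply: sigmaZ; first by rewrite invr_ge0 ltW.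
  by apply: w_interior => i; rewrite !mxE.
Qed.

Variables (T : nat -> set 'rV[int]_d.+1) (C : nat).
Hypothesis T_cube : forall q, (0 < q)%N -> T q `<=` cube (C * q).
Hypothesis T_sub : forall q z, (0 < q)%N -> T q z ->
  sigma (rv z) /\ ~ Q (q%:R^-1 *: rv (z - w)).
Hypothesis sub_T : forall q z, (0 < q)%N ->
  sigma (rv (z - w)) -> ~ Q (q%:R^-1 *: rv z) -> T q z.

Lemma finite_T q : (0 < q)%N -> finite_set (T q).
Proof. by move=> q0; apply: sub_finite_set (@T_cube q q0) (@finite_cube d _). Qed.

(** The points of [cells q] outside [T q], and those of [T q] outside [q P], lie in
    boundary layers of [q Q] and of [sigma], hence number [O(q^d)] in dimension
    [d + 1]. *)
Lemma ncard_comparison : exists c : nat, forall q, (0 < q)%N ->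
  (ncard (cells q) <= ncard (T q) + c * q ^ d)%N /\
  (ncard (T q) <= ncard (lattice_points (closure P) q) + c * q ^ d)%N.
Proof.
have [c1 c1P] := boundary_layer_count (w + w).
have [c2 c2P] := boundary_layer_count w.
pose M := (maxn C (L + 3)).+1.
exists ((c1 + c2) * M ^ d)%N => q q0.
have qR : 0 < q%:R :> R by rewrite ltr0n.
have MC : (C * q <= M * q)%N by rewrite leq_mul2r leqW ?orbT ?leq_maxl.
have ML : ((L + 3) * q <= M * q)%N by rewrite leq_mul2r leqW ?orbT ?leq_maxr.
(* The layer of [X1] is taken along [w + w]: it compares [z + w] with [z - w]. *)
pose X1 := [set z | sigma (rv (z + w))].
pose X2 := [set z | Q (q%:R^-1 *: rv z)].
have X1w z : X1 z -> X1 (z + (w + w)).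
  rewrite /X1 /= => sz; rewrite addrAC rvecD; apply: sigmaD => //.
  by rewrite rvecD; apply: sigmaD; exact: sigma_w.
have X2w z : X2 z -> X2 (z + w).
  rewrite /X2 /= rvecD scalerDr => Qz; apply: QD => //.
  by apply: sigmaZ (sigma_w); rewrite invr_ge0 ltW.
pose B1 := [set z | [/\ cube ((maxn C (L + 3)) * q) z, X1 z & ~ X1 (z - (w + w))]].
pose B2 := [set z | [/\ cube ((maxn C (L + 3)) * q) z, X2 z & ~ X2 (z - w)]].
have cubeS a b z : (a <= b)%N -> cube a z -> cube b z.
  by move=> ab az i; apply: leq_trans (az i) ab.
have finB1 : finite_set B1.
  by apply: sub_finite_set (@finite_cube d (maxn C (L + 3) * q)) => z [].
have finB2 : finite_set B2.
  by apply: sub_finite_set (@finite_cube d (maxn C (L + 3) * q)) => z [].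
have Mq : ((maxn C (L + 3) * q).+1 <= M * q)%N.
  by rewrite /M mulSn -add1n leq_add2r.
have Mqd : ((maxn C (L + 3) * q).+1 ^ d <= M ^ d * q ^ d)%N.
  by rewrite -expnMn; case: (d) => // d'; rewrite leq_exp2r.
have nB1 : (ncard B1 <= c1 * (M ^ d * q ^ d))%N.
  by apply: leq_trans (c1P X1 _ X1w) _; rewrite leq_mul2l Mqd orbT.
have nB2 : (ncard B2 <= c2 * (M ^ d * q ^ d))%N.
  by apply: leq_trans (c2P X2 _ X2w) _; rewrite leq_mul2l Mqd orbT.
have finT := finite_T q0.
split.
  apply: (@leq_trans (ncard (T q `|` (B1 `|` B2)))).
    apply: ncard_sub; first by rewrite !finite_setU.
    move=> z [zL zs zQ]; have [X2z|nX2z] := pselect (X2 z).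
      by right; right; split => //; apply: cubeS zL; rewrite leq_mul2r leq_maxr orbT.
    have [sz|nsz] := pselect (sigma (rv (z - w))); first by left; exact: sub_T.
    right; left; split => //; first by apply: cubeS zL; rewrite leq_mul2r leq_maxr orbT.
    by rewrite /X1 /= opprD addrA subrK.
  apply: leq_trans (ncardU_le _ _) _; rewrite ?finite_setU //.
  rewrite leq_add2l; apply: leq_trans (ncardU_le _ _) _ => //.
  by rewrite -mulnA mulnDl leq_add.
have finK := finite_lattice_points q0.
apply: (@leq_trans (ncard (lattice_points (closure P) q `|` B2))).
  apply: ncard_sub; first by rewrite finite_setU.
  move=> z Tz; have [sz nQz] := T_sub q0 Tz.
  have [X2z|nX2z] := pselect (X2 z).
    by right; split => //; apply: cubeS (T_cube q0 Tz); rewrite leq_mul2r leq_maxl orbT.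
  left; apply: subset_closure; split => //.
  by apply: sigmaZ => //; rewrite invr_ge0 ltW.
apply: leq_trans (ncardU_le _ _) _ => //.
rewrite leq_add2l; apply: leq_trans nB2 _.
by rewrite -mulnA leq_mul2r leq_addl orbT.
Qed.

Lemma vol_fin_num : vol (closure P) \is a fin_num.
Proof.
rewrite ge0_fin_numE; last exact: vol_ge0.
exact: le_lt_trans (vol_le_ncard_cells (ltn0Sn 0)) (ltry _).
Qed.

(** Dividing the comparison by [q^(d+1)], the error is [O(1/q)]: the cube cover
    bounds the volume from above by the count, and nearly optimal covers bound the
    count from above by the volume. *)
Lemma cvg_ncard_vol :
  (fun q => (ncard (T q))%:R / q%:R ^+ d.+1 : R) @ \oo --> fine (vol (closure P)).
Proof.
have [c cP] := ncard_comparison; set v := fine _.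
have vE : vol (closure P) = v%:E by rewrite fineK // vol_fin_num.
apply/cvgrPdist_le => /= e e0.
have e4 : 0 < e / 4 by rewrite divr_gt0.
have [_ [ab /= [ab_le ab_cover] <-] sum_ab] := lb_ereal_inf_adherent e4 vol_fin_num.
rewrite -/(vol (closure P)) vE -EFinD in sum_ab.
have [m0 m0P] := lattice_points_le_cover compact_closure_region ab_le ab_cover (ltW sum_ab) e4.
near=> q.
have q0 : (0 < q)%N by near: q; exact: nbhs_infty_gt.
have qR : 0 < q%:R :> R by rewrite ltr0n.
have qd : 0 < q%:R ^+ d :> R by rewrite exprn_gt0.
have cq : c%:R <= e / 2 * q%:R.
  rewrite -ler_pdivrMl ?divr_gt0 //; near: q; exact: nbhs_infty_ger.
have [cells_le T_le] := cP q q0.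
have {}T_le : (ncard (T q))%:R <= q%:R ^+ d.+1 * (v + e) :> R.
  rewrite -(ler_nat R) in T_le; apply: le_trans T_le _; rewrite natrD natrM natrX.
  have m0q : (m0 <= q)%N by near: q; exact: nbhs_infty_ge.
  have := m0P q m0q q0; have : c%:R * q%:R ^+ d <= e / 2 * q%:R * q%:R ^+ d :> R.
    by rewrite ler_pM2r.
  rewrite exprS; move: (q%:R ^+ d) => *; nra.
have {}cells_le : v * q%:R ^+ d.+1 <= (ncard (T q))%:R + e * q%:R ^+ d.+1.
  have := vol_le_ncard_cells q0; rewrite vE lee_fin ler_pdivlMr ?exprn_gt0 // => vq.
  apply: le_trans vq _; rewrite -(ler_nat R) in cells_le; apply: le_trans cells_le _.
  rewrite natrD natrM natrX lerD2l exprS mulrA ler_pM2r //.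
  by apply: le_trans cq _; rewrite ler_pM2r //; lra.
rewrite distrC ler_distl; apply/andP; split.
  by rewrite ler_pdivlMr ?exprn_gt0 // mulrBl lerBlDr.
by rewrite ler_pdivrMr ?exprn_gt0 // mulrC.
Unshelve. all: by end_near. Qed.

End RegionContent.

(** * Cones, convex hulls and affine semigroups *)

Section ConvexGeometry.
Variables (R : realType) (d : nat).
Implicit Types (X C : set 'rV[R]_d).

Definition convex_cone C := [/\ C 0, forall x y, C x -> C y -> C (x + y)
  & forall c x, 0 <= c -> C x -> C (c *: x)].

Lemma convex_cone_sum C (I : Type) (r : seq I) (F : I -> 'rV[R]_d) :
  convex_cone C -> (forall i, C (F i)) -> C (\sum_(i <- r) F i).
Proof. by move=> [C0 CD _] CF; apply: (big_ind C). Qed.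

Lemma cone_sub X C : convex_cone C -> X `<=` C -> cone X `<=` C.
Proof.
move=> cC XC _ [n [c [s [c0 Xs ->]]]]; apply: convex_cone_sum => // i.
by case: cC => _ _; apply => //; apply: XC.
Qed.

Lemma sub_cone X : X `<=` cone X.
Proof.
move=> x Xx; exists 1%N, (fun=> 1), (fun=> x); split => //.
by rewrite big_ord1 scale1r.
Qed.

Lemma cone_convex_cone X : convex_cone (cone X).
Proof.
split.
- by exists 0%N, (fun=> 0), (fun=> 0); split => [//|[]|] //; rewrite big_ord0.
- move=> _ _ [n [c [s [c0 Xs ->]]]] [n' [c' [s' [c'0 Xs' ->]]]].
  pose cc i := match fintype.split i with inl j => c j | inr j => c' j end.
  pose ss i := match fintype.split i with inl j => s j | inr j => s' j end.
  exists (n + n')%N, cc, ss; split.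
  + by move=> i; rewrite /cc; case: fintype.split.
  + by move=> i; rewrite /ss; case: fintype.split.
  + rewrite big_split_ord /=; congr (_ + _); apply: eq_bigr => i _; rewrite /cc /ss.
      by rewrite (unsplitK (inl i)).
    by rewrite (unsplitK (inr i)).
- move=> a _ a0 [n [c [s [c0 Xs ->]]]]; exists n, (fun i => a * c i), s; split => //.
    by move=> i; rewrite mulr_ge0.
  by rewrite scaler_sumr; apply: eq_bigr => i _; rewrite scalerA.
Qed.

Lemma finite_cone_convex_cone m (g : 'I_m -> 'rV[R]_d) :
  convex_cone [set x | exists2 l, (forall j, 0 <= l j) & x = \sum_j l j *: g j].
Proof.
split.
- by exists (fun=> 0) => //; rewrite big1 // => j _; rewrite scale0r.
- move=> _ _ [l l0 ->] [l' l'0 ->]; exists (fun j => l j + l' j).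
    by move=> j; rewrite addr_ge0.
  by rewrite -big_split; apply: eq_bigr => j _; rewrite scalerDl.
- move=> c _ c0 [l l0 ->]; exists (fun j => c * l j).
    by move=> j; rewrite mulr_ge0.
  by rewrite scaler_sumr; apply: eq_bigr => j _; rewrite scalerA.
Qed.

(** Collecting equal points turns a convex combination of unbounded length into one
    indexed by the finite family. *)
Lemma convex_hull_family X m (a : 'I_m -> 'rV[R]_d) x :
  (forall y, X y -> exists j, y = a j) -> convex_hull X x ->
  exists l : 'I_m -> R, [/\ forall j, 0 <= l j, \sum_j l j = 1 & x = \sum_j l j *: a j].
Proof.
move=> Xa [n [c [s [c0 c1 Xs ->]]]].
have /choice[f fP] : forall i, exists j, s i = a j by move=> i; exact: Xa.
exists (fun j => \sum_(i | f i == j) c i); split.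
- by move=> j; apply: sumr_ge0.
- by rewrite -c1 [RHS](partition_big f xpredT).
- rewrite (partition_big f xpredT) //=; apply: eq_bigr => j _.
  by rewrite scaler_suml; apply: eq_bigr => i /eqP <-; rewrite fP.
Qed.

End ConvexGeometry.

Section Generation.
Variables (M : zmodType).

(** A boolean predicate, so that it can carry the closure structure over which
    finite generation quantifies. *)
Definition nat_span (gens : seq M) : {pred M} := fun v =>
  `[< exists n : 'I_(size gens) -> nat, v = \sum_(j < size gens) (nth 0 gens j) *+ n j >].

Lemma nat_span_addr_closed gens : addr_closed (nat_span gens).
Proof.
split.
  by apply/asboolP; exists (fun=> 0%N); rewrite big1 // => j _; rewrite mulr0n.
move=> u v /asboolP[n ->] /asboolP[n' ->]; apply/asboolP.
exists (fun j => (n j + n' j)%N); rewrite -big_split; apply: eq_bigr => j _.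
by rewrite mulrnDr.
Qed.

HB.instance Definition _ gens :=
  GRing.isAddClosed.Build M (nat_span gens) (nat_span_addr_closed gens).

Variable S : addrClosed M.

Definition differences : {pred M} := fun v =>
  `[< exists s s', [/\ s \in S, s' \in S & v = s - s'] >].

Lemma differences_zmod_closed : zmod_closed differences.
Proof.
split.
  by apply/asboolP; exists 0, 0; rewrite rpred0 subr0.
move=> u v /asboolP[s [s' [Ss Ss' ->]]] /asboolP[r [r' [Sr Sr' ->]]].
apply/asboolP; exists (s + r'), (s' + r); split; rewrite ?rpredD //.
by rewrite opprB addrACA -opprD.
Qed.

HB.instance Definition _ :=
  GRing.isZmodClosed.Build M differences differences_zmod_closed.

Lemma finitely_generated_family : finitely_generated_monoid S ->
  exists m (g : 'I_m -> submonoid S), forall s : submonoid S,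
    exists n : 'I_m -> nat, s = \sum_j g j *+ n j.
Proof.
move=> [gens gensS gen]; exists (size gens).
have gS (j : 'I_(size gens)) : nth 0 gens j \in S by rewrite gensS // mem_nth.
exists (fun j => Submonoid (gS j)) => s.
have /asboolP[n sE] : val s \in nat_span gens.
  apply: gen (valP s) => v vg; apply/asboolP.
  have vi : (index v gens < size gens)%N by rewrite index_mem.
  exists (fun j => (j == Ordinal vi) : nat).
  rewrite (bigD1 (Ordinal vi)) //= eqxx mulr1n nth_index // big1 ?addr0 //.
  by move=> j /negPf ->; rewrite mulr0n.
exists n; apply: val_inj; rewrite sE raddf_sum; apply: eq_bigr => j _.
by rewrite raddfMn.
Qed.

Lemma generates_group_differences : generates_group S ->
  forall v : M, exists s s' : submonoid S, v = val s - val s'.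
Proof.
move=> gen v; have /asboolP[s [s' [Ss Ss' ->]]] : v \in differences.
  apply: gen => u Su; apply/asboolP; exists u, 0.
  by rewrite Su rpred0 subr0.
by exists (Submonoid Ss), (Submonoid Ss').
Qed.

End Generation.

Section AffineSemigroup.
Variables (R : realType) (d : nat) (M : zmodType).
Variables (phi : {additive M -> 'rV[int]_d.+1}) (hphi : bijective phi).
Variable S : addrClosed M.
Hypotheses (hSfg : finitely_generated_monoid S) (hSgen : generates_group S).
Notation K := (submonoid S).
Notation sigma := (sigma_dual S phi : set 'rV[R]_d.+1).
Notation real_pt := (realify R phi).

Definition rho (v : K) : 'rV[R]_d.+1 := real_pt (val v).

Lemma real_ptE v : real_pt v = rvec R (phi v). Proof. by []. Qed.

Lemma real_ptD u v : real_pt (u + v) = real_pt u + real_pt v.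
Proof. by rewrite !real_ptE raddfD rvecD. Qed.

Lemma real_ptN v : real_pt (- v) = - real_pt v.
Proof. by rewrite !real_ptE raddfN rvecN. Qed.

Lemma rhoD u v : rho (u + v) = rho u + rho v.
Proof. by rewrite /rho raddfD real_ptD. Qed.

Lemma rho0 : rho 0 = 0.
Proof. by apply: (addIr (rho 0)); rewrite -rhoD !add0r. Qed.

Lemma rhoMn v n : rho (v *+ n) = n%:R *: rho v.
Proof.
elim: n => [|n IH]; first by rewrite mulr0n rho0 scale0r.
by rewrite mulrS rhoD IH -natr1 scalerDl scale1r addrC.
Qed.

Lemma rho_sum (I : Type) (r : seq I) (F : I -> K) :
  rho (\sum_(i <- r) F i) = \sum_(i <- r) rho (F i).
Proof. exact: (big_morph rho rhoD rho0). Qed.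

Lemma sigma_cone : convex_cone sigma. Proof. exact: cone_convex_cone. Qed.

Lemma sigma_rho v : sigma (rho v).
Proof. by apply: sub_cone; exists (val v) => //; exact: valP. Qed.

Lemma sigma0 : sigma 0. Proof. by case: sigma_cone. Qed.
Lemma sigmaD x y : sigma x -> sigma y -> sigma (x + y).
Proof. by case: sigma_cone => _ + _; apply. Qed.
Lemma sigmaZ c x : 0 <= c -> sigma x -> sigma (c *: x).
Proof. by case: sigma_cone => _ _; apply. Qed.

Lemma submonoid_addIr (u v s : K) : u + s = v + s -> u = v.
Proof.
move=> /(congr1 val); rewrite !raddfD => /addIr uv; exact: val_inj.
Qed.

Lemma submonoid_torsion_free (s : K) n : s *+ n.+1 = 0 -> s = 0.
Proof.
move=> s0; have sn : phi (val s) *+ n.+1 = 0.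
  by rewrite -!raddfMn s0 !raddf0.
apply: val_inj; apply: (bij_inj hphi); rewrite !raddf0.
apply/rowP => i; move/rowP/(_ i): sn; rewrite mulmxnE !mxE => /eqP.
by rewrite mulrn_eq0 /= => /eqP.
Qed.

Section Family.
Variables (m : nat) (g : 'I_m -> K).

Definition gen_size := (\sum_j \sum_i `|phi (val (g j)) 0%R i|)%N.

(** Generators equal to zero contribute nothing, hence only the coefficients of the
    others need to be bounded. *)
Lemma family_bound (l : 'I_m -> R) (b : R) : (forall j, 0 <= l j) ->
  (forall j, g j <> 0 -> l j <= b) ->
  forall i, `|(\sum_j l j *: rho (g j)) 0 i| <= b * gen_size%:R.
Proof.
move=> l0 lb i; rewrite summxE; apply: le_trans (ler_norm_sum _ _ _) _.
rewrite /gen_size natr_sum mulr_sumr; apply: ler_sum => j _.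
rewrite !mxE normrM ger0_norm // -intr_norm -natr_absz.
have [->|/eqP gj] := eqVneq (g j) 0.
  have -> : phi (val (0 : K)) = 0 by rewrite !raddf0.
  rewrite mxE absz0 mulr0 big1 ?mulr0 // => k _.
  by rewrite mxE absz0.
have lbj := lb _ gj; apply: ler_pM => //.
by rewrite ler_nat (bigD1 i) //= leq_addr.
Qed.

End Family.

Lemma sigma_family m (g : 'I_m -> K) :
  (forall s : K, exists n : 'I_m -> nat, s = \sum_j g j *+ n j) ->
  forall x, sigma x -> exists2 l, (forall j, 0 <= l j) & x = \sum_j l j *: rho (g j).
Proof.
move=> gen; apply: cone_sub; first exact: finite_cone_convex_cone.
move=> _ [v Sv <-]; have [n] := gen (Submonoid Sv).
move=> /(congr1 rho) e; exists (fun j => (n j)%:R) => //.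
rewrite -[real_pt v]/(rho (Submonoid Sv)) e rho_sum.
by apply: eq_bigr => j _; rewrite rhoMn.
Qed.

(** Write a lattice point of [sigma] as a nonnegative combination of the
    generators and remove the integral parts of the coefficients: what remains is one
    of finitely many lattice points, each a difference [s - s'] of elements of [S].
    Adding the sum [c] of all the [s'] makes all of them elements of [S]. *)
Lemma conductor : exists c : K, forall z : M,
  sigma (real_pt z - rho c) -> z \in S.
Proof.
have [m [g gen]] := finitely_generated_family hSfg.
have /choice[f fP] := generates_group_differences hSgen.
have /choice[f' f'P] : forall v, exists s' : K, v = val (f v) - val s' by [].
pose F := [set z : M | exists2 l : 'I_m -> R, forall j, 0 <= l j <= 1
  & real_pt z = \sum_j l j *: rho (g j)].
have finF : finite_set F.
  apply: (finite_inj (f := phi) (@finite_cube d (gen_size g))).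
    by move=> x y _ _; exact: bij_inj.
  move=> z [l l01 zE] i; rewrite -(ler_nat R) natr_absz intr_norm.
  have -> : (phi z 0 i)%:~R = (real_pt z) 0 i by rewrite mxE.
  rewrite zE -[leRHS]mul1r; apply: family_bound => j; first by case/andP: (l01 j).
  by case/andP: (l01 j).
exists (\sum_(z <- fset_set F) f' z) => z /(sigma_family gen)[l l0 zl].
pose k j := Num.truncn (l j).
pose z' := z - val (\sum_(z <- fset_set F) f' z) - val (\sum_j g j *+ k j).
have Fz' : F z'.
  exists (fun j => l j - (k j)%:R).
    move=> j; have := truncn_itv (l0 j); rewrite -natr1 => /andP[k1 k2].
    by apply/andP; split; lra.
  rewrite /z' 2!real_ptD !real_ptN -/(rho _) -/(rho _) zl rho_sum -sumrB.
  by apply: eq_bigr => j _; rewrite rhoMn scalerBl.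
have -> : z = z' + val (\sum_(z <- fset_set F) f' z) + val (\sum_j g j *+ k j).
  by rewrite /z' addrAC subrK subrK.
have -> : \sum_(z <- fset_set F) f' z = f' z' + \sum_(z <- rem z' (fset_set F)) f' z.
  by rewrite (big_rem z') //= in_fset_set // inE.
rewrite {1}(f'P z') raddfD addrA subrK.
by rewrite !rpredD //; exact: valP.
Qed.

(** Each coordinate vector is a difference [s i - s' i] of elements of [S]. With [w]
    twice the sum of all [s i + s' i], a perturbation [y] changes the coefficients of
    [s i] and [s' i] from 2 to [2 + y i] and [2 - y i]. *)
Lemma interior_point : exists w : K, forall y : 'rV[R]_d.+1,
  (forall i, `|y 0 i| <= 2) -> sigma (rho w + y).
Proof.
have [psi phiK psiK] := hphi.
have /choice[s sP] : forall i : 'I_d.+1, exists s : K * K,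
    psi (delta_mx 0 i) = val s.1 - val s.2.
  move=> i; have [s [s' e]] := generates_group_differences hSgen (psi (delta_mx 0 i)).
  by exists (s, s').
have deltaE i : delta_mx 0 i = rho (s i).1 - rho (s i).2 :> 'rV[R]_d.+1.
  rewrite /rho -real_ptN -real_ptD -sP real_ptE psiK.
  by apply/rowP => j; rewrite !mxE; case: (_ && _).
exists (\sum_i ((s i).1 + (s i).2) *+ 2) => y y2.
have -> : rho (\sum_i ((s i).1 + (s i).2) *+ 2) + y =
    \sum_i ((2 + y 0 i) *: rho (s i).1 + (2 - y 0 i) *: rho (s i).2).
  rewrite rho_sum [X in _ + X]row_sum_delta -big_split /=; apply: eq_bigr => i _.
  rewrite deltaE rhoMn rhoD scalerDr scalerBr !scalerDl scaleNr.
  by rewrite addrACA.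
apply: convex_cone_sum sigma_cone _ => i.
have := y2 i; rewrite ler_norml => /andP[yl yu].
by apply: sigmaD; apply: sigmaZ (sigma_rho _); lra.
Qed.

End AffineSemigroup.

Lemma finite_set_family (T : choiceType) (x0 : T) (A : set T) : finite_set A ->
  exists m (a : 'I_m -> T), (forall j, A (a j)) /\ (forall x, A x -> exists j, x = a j).
Proof.
move=> /finite_seqP[s ->]; exists (size s), (fun j => nth x0 s j); split.
  by move=> j /=; exact: mem_nth.
move=> x /= xs; have xi : (index x s < size s)%N by rewrite index_mem.
by exists (Ordinal xi); rewrite /= nth_index.
Qed.

(** * Exponents missing from the ideals, and the region *)

Section Asymptotics.
Variables (R : realType) (d : nat) (M : zmodType).
Variables (phi : {additive M -> 'rV[int]_d.+1}) (hphi : bijective phi).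
Variable S : addrClosed M.
Hypotheses (hSfg : finitely_generated_monoid S) (hSgen : generates_group S).
Notation K := (submonoid S).
Notation sigma := (sigma_dual S phi : set 'rV[R]_d.+1).
Notation rho := (@rho R d M phi S).
Let addKK := @submonoid_addIr _ S.
Let torsfree := submonoid_torsion_free hphi (S := S).

(** Only nonzero generators are concerned: their multiples are pairwise distinct,
    so they eventually enter [E]. *)
Lemma upset_multiples m (g : 'I_m -> K) (E : set K) : upset E ->
  finite_set (~` E) -> exists N, forall j k, g j <> 0 -> (N <= k)%N -> E (g j *+ k).
Proof.
move=> upE finE.
have /choice[f fP] : forall j, exists n, g j <> 0 -> E (g j *+ n).
  move=> j; have [->|/eqP gj] := eqVneq (g j) 0; first by exists 0%N.
  by have [n] := exists_multiple addKK torsfree 0 finE gj; rewrite add0r; exists n.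
exists (\sum_j f j)%N => j k gj fk.
have fjk : (f j <= k)%N by apply: leq_trans fk; rewrite (bigD1 j) //= leq_addr.
by rewrite -(subnKC fjk) mulrnDr; apply/upE/fP.
Qed.

Variables (A B : set K) (t : R) (n : nat -> nat).
Hypotheses (finA : finite_set A) (t0 : 0 < t).
Hypotheses (cofinA : finite_set (~` upclosure A)) (cofinB : finite_set (~` upclosure B)).
Hypothesis n_ceil : forall q, (0 < q)%N -> t * q%:R <= (n q)%:R <= t * q%:R + 1.

(** The exponents of the monomials of the product of the [n q]-th power of the ideal
    of [A] and the [q]-th Frobenius power of the ideal of [B]. *)
Definition exponents q : set K :=
  upclosure (addset (nfold A (n q)) [set b *+ q | b in B]).

Let pi (v : K) := phi (val v).

Lemma pi_inj : injective pi.
Proof. by move=> u v /(bij_inj hphi); exact: val_inj. Qed.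

(** The exponents outside the ideal, seen in [Z^(d+1)]; their number is the length
    of the quotient. *)
Definition missing q : set 'rV[int]_d.+1 := pi @` (~` exponents q).

Let H := convex_hull [set rho v | v in A].
Let Q : set 'rV[R]_d.+1 :=
  minkowski_sum (minkowski_sum [set rho v | v in B] [set t *: x | x in H]) sigma.

Lemma Q_intro b h y x : B b -> H h -> sigma y -> x = rho b + t *: h + y -> Q x.
Proof.
move=> Bb Hh sy ->; exists (rho b + t *: h); last by exists y.
by exists (rho b); [exists b|exists (t *: h) => //; exists h].
Qed.

Lemma Q_addr x y : Q x -> sigma y -> Q (x + y).
Proof.
move=> [_ [_ [b Bb <-] [_ [h Hh <-] <-]] [z sz <-]] sy.
by apply: (Q_intro Bb Hh (sigmaD sz sy)); rewrite addrA.
Qed.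

Lemma H_rho a : A a -> H (rho a).
Proof.
move=> Aa; exists 1%N, (fun=> 1), (fun=> rho a); split => //.
- by rewrite big_ord1.
- by move=> _; exists a.
- by rewrite big_ord1 scale1r.
Qed.

(** A large coefficient on a nonzero generator [g] already places a point in [Q]: some
    multiple of [g] is in [b + S] and some multiple is in [a + S]. *)
Lemma region_bounded : exists L : nat, forall x : 'rV[R]_d.+1,
  (sigma `\` Q) x -> forall i, `|x 0 i| <= L%:R.
Proof.
have [m [g gen]] := finitely_generated_family hSfg.
have [NA NAP] := upset_multiples g (@upset_upclosure _ A) cofinA.
have [NB NBP] := upset_multiples g (@upset_upclosure _ B) cofinB.
pose b := NB%:R + t * NA%:R.
exists (Num.truncn (b * (gen_size phi g)%:R)).+1 => x [sx nQx] i.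
apply: le_trans (ltW (truncnS_gt _)).
have [l l0 xl] := sigma_family gen sx; rewrite xl.
apply: family_bound => // j gj; rewrite leNgt; apply/negP => blj; apply: nQx.
have [bb [s [Bb sE]]] := NBP j _ gj (leqnn _).
have [a [s' [Aa s'E]]] := NAP j _ gj (leqnn _).
apply: (Q_intro Bb (H_rho Aa) (y := rho s + t *: rho s' +
    ((l j - b) *: rho (g j) + \sum_(i | i != j) l i *: rho (g i)))).
  apply: sigmaD; first by apply: sigmaD (sigma_rho _ _ _) (sigmaZ (ltW t0) (sigma_rho _ _ _)).
  apply: sigmaD; first by apply: sigmaZ (sigma_rho _ _ _); rewrite subr_ge0 ltW.
  rewrite big_mkcond; apply: convex_cone_sum (sigma_cone _ _ _) _ => k.
  by case: ifP => _; [exact: sigmaZ (sigma_rho _ _ _)|exact: sigma0].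
rewrite xl (bigD1 j) //= ![in RHS]addrA; congr (_ + _).
rewrite -[_ + rho s + _]addrA addrACA -scalerDr -!rhoD -sE -s'E !rhoMn scalerA -!scalerDl.
by rewrite -/b subrKC.
Qed.

(** The same argument as for the boundedness of the region, with natural coefficients:
    [NB * q + NA * n q] copies of a generator suffice, and [n q] is [O(q)]. *)
Lemma missing_cube : exists C, forall q, (0 < q)%N -> missing q `<=` cube (C * q).
Proof.
have [m [g gen]] := finitely_generated_family hSfg.
have [NA NAP] := upset_multiples g (@upset_upclosure _ A) cofinA.
have [NB NBP] := upset_multiples g (@upset_upclosure _ B) cofinB.
pose tt := (Num.truncn t).+2.
have ntt q : (0 < q)%N -> (n q <= tt * q)%N.
  move=> q0; have /andP[_ nq] := n_ceil q0.
  rewrite -(ler_nat R); apply: le_trans nq _; rewrite natrM /tt -natr1.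
  have := truncnS_gt t; have : 1 <= q%:R :> R by rewrite ler1n.
  move: ((Num.truncn t).+1%:R : R) (q%:R : R) => *; nra.
exists ((NB + NA * tt) * gen_size phi g)%N => q q0 _ [u nEu <-] i.
have [k uk] := gen u.
have rk : rho u = \sum_j (k j)%:R *: rho (g j).
  by rewrite uk rho_sum; apply: eq_bigr => j _; rewrite rhoMn.
rewrite -(ler_nat R) natr_absz intr_norm.
have -> : (pi u 0 i)%:~R = rho u 0 i by rewrite [RHS]mxE.
have -> : ((NB + NA * tt) * gen_size phi g * q)%N = ((NB + NA * tt) * q * gen_size phi g)%N.
  by rewrite mulnAC.
rewrite natrM rk; apply: family_bound => // j gj.
rewrite ler_nat leqNgt; apply/negP => kj; apply: nEu.
have [bb [s [Bb sE]]] := NBP j _ gj (leqnn _).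
have [a [s' [Aa s'E]]] := NAP j _ gj (leqnn _).
have le : (NA * n q + NB * q <= k j)%N.
  apply: leq_trans (ltnW kj); rewrite mulnDl addnC leq_add2l -mulnA leq_mul2l.
  by rewrite ntt // orbT.
exists (a *+ n q + bb *+ q),
  (s' *+ n q + s *+ q + (g j *+ (k j - (NA * n q + NB * q)) + \sum_(i | i != j) g i *+ k i)).
split.
  by exists (a *+ n q); [exact: nfoldMn|exists (bb *+ q) => //; exists bb].
have -> : u = g j *+ k j + \sum_(i | i != j) g i *+ k i by rewrite uk (bigD1 j).
suff -> : g j *+ k j = (a *+ n q + bb *+ q) + (s' *+ n q + s *+ q +
    g j *+ (k j - (NA * n q + NB * q))) by rewrite -!addrA.
by rewrite addrA addrACA -!mulrnDl -s'E -sE -!mulrnA -!mulrnDr subnKC.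
Qed.

Lemma finite_missing q : (0 < q)%N -> finite_set (~` exponents q).
Proof.
move=> q0; have [C CP] := missing_cube.
apply: (finite_inj (f := pi) (@finite_cube d (C * q))).
  by move=> u v _ _; exact: pi_inj.
by move=> u nEu; apply: CP => //; exists u.
Qed.

Lemma ncard_missing q : (0 < q)%N -> ncard (missing q) = ncard (~` exponents q).
Proof.
move=> q0; have fin := finite_missing q0.
rewrite /ncard /missing fset_set_image // card_imfset //; exact: pi_inj.
Qed.

(** A sum [x] of [n q] elements of [A] is [n q] times a point of the hull; the excess
    [n q - t q >= 0] is absorbed by the cone. *)
Lemma exponents_sub q u : (0 < q)%N -> exponents q u -> Q (q%:R^-1 *: rho u).
Proof.
move=> q0 [_ [y [[x nx [_ [b Bb <-] <-]] ->]]].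
have qR : 0 < q%:R :> R by rewrite ltr0n.
have /andP[tq _] := n_ceil q0.
have n0 : 0 < (n q)%:R :> R by apply: lt_le_trans tq; rewrite mulr_gt0.
apply: (Q_intro (b := b) (h := (n q)%:R^-1 *: rho x)
  (y := q%:R^-1 *: ((1 - t * q%:R / (n q)%:R) *: rho x + rho y))) => //.
- have [a Aa ->] := nfold_split nx; rewrite rho_sum scaler_sumr.
  exists (n q), (fun=> (n q)%:R^-1), (fun i => rho (a i)); split => //.
  + by rewrite sumr_const card_ord -[LHS]mulr_natr mulVf ?gt_eqF.
  + by move=> i; exists (a i).
- apply: sigmaZ; first by rewrite invr_ge0 ltW.
  apply: sigmaD; last exact: sigma_rho.
  apply: sigmaZ; last exact: sigma_rho.
  by rewrite subr_ge0 ler_pdivrMr // mul1r.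
- rewrite !rhoD rhoMn !scalerDr !scalerA mulVf ?gt_eqF // scale1r !addrA.
  congr (_ + _); rewrite [LHS]addrC -addrA; congr (_ + _).
  rewrite -scalerDl; congr (_ *: _); field.
  by rewrite !gt_eqF.
Qed.

(** The first two properties come from an interior point and a conductor. For the
    third, a point of [q Q] involves [t q] times a convex combination of [A]. Rounding
    down its coefficients leaves a sum of at most [n q] elements of [A], and at most
    [m + 1] more, for [m] the length of a list of [A], bring it to exactly [n q]; the
    [m + 1] copies of each element of [A] in [w] pay for them. What is left lies in
    the conductor. *)
Lemma deep_point : exists w : K, [/\
  forall y : 'rV[R]_d.+1, (forall i, `|y 0 i| <= 2) -> sigma (rho w + y),
  forall z : M, sigma (realify R phi z - rho w) -> z \in S
  & forall q u, (0 < q)%N -> Q (q%:R^-1 *: (rho u - rho w)) -> exponents q u].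
Proof.
have [w0 w0P] := interior_point R hphi hSgen.
have [c cP] := conductor R hphi hSfg hSgen.
have [m [a [Aa aA]]] := finite_set_family 0 finA.
pose asum := \sum_j a j *+ m.+1.
have sDr := sigma_rho R phi.
exists (w0 + c + asum); split.
- move=> y y2; rewrite !rhoD -!addrA [_ + (_ + y)]addrA [_ + y]addrC addrA.
  by apply: sigmaD (w0P y y2) _; apply: sigmaD.
- move=> z zw; apply: cP.
  have -> : realify R phi z - rho c =
      (realify R phi z - rho (w0 + c + asum)) + (rho w0 + rho asum).
    rewrite !rhoD; move: (realify _ _ _) (rho w0) (rho c) (rho asum) => p x1 x2 x3.
    by apply/rowP => i; rewrite !mxE; ring.
  by apply: sigmaD => //; apply: sigmaD.
move=> q u q0 [_ [_ [b Bb <-] [_ [h Hh <-] <-]] [y sy quw]].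
have qR : 0 < q%:R :> R by rewrite ltr0n.
have [l [l0 l1 hE]] : exists l : 'I_m -> R,
    [/\ forall j, 0 <= l j, \sum_j l j = 1 & h = \sum_j l j *: rho (a j)].
  apply: convex_hull_family Hh => _ [v Av <-].
  by have [j ->] := aA v Av; exists j.
have [j0 _] : exists j0 : 'I_m, true.
  case: (m) (l) l1 => [l'|m' _ _]; last by exists ord0.
  by rewrite big_ord0 => /eqP; rewrite eq_sym oner_eq0.
have /andP[tn nt] := n_ceil q0; set x := t * q%:R in tn nt.
have x0 : 0 <= x by rewrite mulr_ge0 // ltW.
pose k j := Num.truncn (x * l j).
have kP j : (k j)%:R <= x * l j <= (k j)%:R + 1.
  have := truncn_itv (mulr_ge0 x0 (l0 j)); rewrite -/(k j) -natr1.
  by move=> /andP[-> /ltW].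
have sumx : \sum_j x * l j = x by rewrite -mulr_sumr l1 mulr1.
have kn : (\sum_j k j <= n q)%N.
  rewrite -(ler_nat R); apply: le_trans tn; rewrite -sumx natr_sum.
  by apply: ler_sum => j _; case/andP: (kP j).
pose r := (n q - \sum_j k j)%N.
have rm : (r <= m.+1)%N.
  rewrite /r leq_subLR -(ler_nat R) natrD; apply: le_trans nt _.
  rewrite -natr1 addrA lerD2r -sumx natr_sum.
  have -> : m%:R = \sum_(j < m) 1 :> R by rewrite sumr_const card_ord.
  by rewrite -big_split; apply: ler_sum => j _; case/andP: (kP j).
pose al := \sum_j a j *+ k j + a j0 *+ r.
have nal : nfold A (n q) al.
  by rewrite -(subnKC kn); apply: nfoldD; [exact: nfold_sum|exact: nfoldMn].
pose v := val u - val (al + b *+ q).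
have vS : v \in S.
  apply: cP; rewrite /v real_ptD real_ptN -![realify _ _ _]/(rho _).
  have uE : rho u = rho (w0 + c + asum) + q%:R *: (rho b + t *: h + y).
    by rewrite quw scalerA mulfV ?gt_eqF // scale1r subrKC.
  have -> : rho u - rho (al + b *+ q) - rho c = rho w0 +
      ((\sum_(j | j != j0) m.+1%:R *: rho (a j) + (m.+1 - r)%:R *: rho (a j0)) +
       (\sum_j (x * l j - (k j)%:R) *: rho (a j) + q%:R *: y)).
    have asumE : rho asum =
        \sum_(j | j != j0) m.+1%:R *: rho (a j) + m.+1%:R *: rho (a j0).
      rewrite rho_sum (bigD1 j0) //= addrC rhoMn; congr (_ + _).
      by apply: eq_bigr => j _; rewrite rhoMn.
    have alE : rho al = \sum_j (k j)%:R *: rho (a j) + r%:R *: rho (a j0).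
      rewrite rhoD rhoMn rho_sum; congr (_ + _).
      by apply: eq_bigr => j _; rewrite rhoMn.
    have xhE : q%:R *: (t *: h) = \sum_j (x * l j) *: rho (a j).
      by rewrite hE !scaler_sumr; apply: eq_bigr => j _; rewrite !scalerA /x [q%:R * t]mulrC.
    have -> : \sum_j (x * l j - (k j)%:R) *: rho (a j) =
        q%:R *: (t *: h) - \sum_j (k j)%:R *: rho (a j).
      by rewrite xhE -sumrB; apply: eq_bigr => j _; rewrite scalerBl.
    rewrite uE (rhoD R phi al) (rhoD R phi _ asum) asumE alE (rhoD R phi w0) rhoMn.
    rewrite (natrB _ rm) !scalerDr.
    move: (\sum_(j | j != j0) _) (\sum_j _) => v1 v2.
    by apply/rowP => i; rewrite !mxE; ring.
  apply: sigmaD => //; apply: sigmaD; apply: sigmaD.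
  - rewrite big_mkcond; apply: convex_cone_sum (sigma_cone _ _ _) _ => j.
    by case: ifP => _; [apply: sigmaZ|exact: sigma0].
  - exact: sigmaZ.
  - apply: convex_cone_sum (sigma_cone _ _ _) _ => j; apply: sigmaZ => //.
    by rewrite subr_ge0; case/andP: (kP j).
  - by apply: sigmaZ => //; exact: ltW.
exists (al + b *+ q), (Submonoid vS); split.
  by exists al => //; exists (b *+ q) => //; exists b.
by apply: val_inj; rewrite raddfD /= /v subrKC.
Qed.

Lemma cvg_ncard_missing :
  (fun q => (ncard (~` exponents q))%:R / q%:R ^+ d.+1 : R) @ \oo
    --> fine (vol (closure (sigma `\` Q))) /\
  vol (closure (sigma `\` Q)) \is a fin_num.
Proof.
have [w [w_int w_cond w_exp]] := deep_point.
have [L LP] := region_bounded.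
have [C CP] := missing_cube.
have T_sub q z : (0 < q)%N -> missing q z ->
    sigma (rvec R z) /\ ~ Q (q%:R^-1 *: rvec R (z - pi w)).
  move=> q0 [u nEu <-]; split; first exact: sigma_rho.
  by rewrite rvecB => /(w_exp _ _ q0).
have sub_T q z : (0 < q)%N -> sigma (rvec R (z - pi w)) ->
    ~ Q (q%:R^-1 *: rvec R z) -> missing q z.
  have [psi phiK psiK] := hphi.
  move=> q0; rewrite rvecB -[z]psiK => sz nQz.
  have vS : psi z \in S by exact: w_cond.
  by exists (Submonoid vS) => // /(exponents_sub q0).
split; last exact: (vol_fin_num (@sigmaD _ _ _ phi S) (@sigmaZ _ _ _ phi S) Q_addr w_int LP).
have cv := cvg_ncard_vol (@sigmaD _ _ _ phi S) (@sigmaZ _ _ _ phi S) Q_addr w_int LP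
  CP T_sub sub_T.
apply: cvg_trans cv; apply: near_eq_cvg; near=> q.
have q0 : (0 < q)%N by near: q; exact: nbhs_infty_gt.
by rewrite ncard_missing.
Unshelve. all: by end_near. Qed.

End Asymptotics.

Theorem theorem6p3 (R : realType) (k : fieldType) (p : nat)
  (hp : p \in [pchar k])
  (d : nat) (hd : (1 <= d)%N)
  (M : zmodType) (phi : {additive M -> 'rV[int]_d}) (hphi : bijective phi)
  (S : addrClosed M)
  (hSfg : finitely_generated_monoid S) (hSgen : generates_group S)
  (calA calB : set (submonoid S))
  (hAfin : finite_set calA) (hBfin : finite_set calB)
  (I a : set (monoid_algebra k (submonoid S)))
  (hI : I = monomial_ideal calB) (ha : a = monomial_ideal calA)
  (hIcol : (colength R I < +oo)%E) (hacol : (colength R a < +oo)%E)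
  (t : R) (ht : 0 < t) :
  [/\ cvgn (eHK_seq p d a t I),
      eHK p d a t I \is a fin_num
    & eHK p d a t I = vol (closure (P_region phi calA calB t))].
Proof.
case: d hd phi hphi => // d' _ {}phi {}hphi.
have pr_p := pcharf_prime hp.
pose n q := `|Num.ceil (t * q%:R)|%N.
have n_ceil q : (0 < q)%N -> t * q%:R <= (n q)%:R <= t * q%:R + 1.
  move=> q0; have x0 : 0 <= t * q%:R by rewrite mulr_ge0 // ltW.
  rewrite natr_absz ger0_norm ?ceil_ge0 ?(lt_le_trans _ x0) ?ltrN10 // ceil_ge /=.
  by rewrite -lerBlDr ltW // -[X in _ - X]/(1%:~R) -intrB ceilB1_lt.
have addK := @submonoid_addIr M S.
have torsf := submonoid_torsion_free hphi (S := S).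
have cofin (C : set (submonoid S)) (J : set (monoid_algebra k (submonoid S))) :
    J = monomial_ideal C -> (colength R J < +oo)%E -> finite_set (~` upclosure C).
  move=> ->; rewrite monomial_idealE => fC.
  exact: (finite_compl_of_colength addK torsf (@upset_upclosure _ C) fC).
have cofinA := cofin _ _ ha hacol; have cofinB := cofin _ _ hI hIcol.
have [cv fin] := cvg_ncard_missing hphi hSfg hSgen hAfin ht cofinA cofinB n_ceil.
rewrite -[vol _]/(vol (closure (P_region phi calA calB t))) in cv fin.
have seqE e : eHK_seq p d'.+1 a t I e =
    ((ncard (~` exponents calA calB n (p ^ e)))%:R / (p ^ e)%:R ^+ d'.+1)%:E.
  have q0 : (0 < p ^ e)%N by rewrite expn_gt0 prime_gt0.
  rewrite /eHK_seq hI ha ideal_exp_monomial frobenius_power_monomial //.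
  rewrite ideal_mul_monomial monomial_idealE.
  rewrite (colength_supported R k addK torsf (@upset_upclosure _ _)).
  rewrite -/(exponents calA calB n (p ^ e)).
    by rewrite -EFinM expnM natrX.
  exact: (finite_missing hphi hSfg cofinA cofinB n_ceil q0).
have cvE : eHK_seq p d'.+1 a t I @ \oo --> vol (closure (P_region phi calA calB t)).
  pose u q : R := (ncard (~` exponents calA calB n q))%:R / q%:R ^+ d'.+1.
  rewrite -(fineK fin) (_ : eHK_seq _ _ _ _ _ = EFin \o (u \o expn p)); last first.
    by apply/funext => e; rewrite seqE.
  apply: cvg_EFin; first exact: nearW.
  apply: cvg_comp cv => N [m _ mN]; exists m => // e /= me; apply: mN => /=.
  by apply: leq_trans me (ltnW _); rewrite ltn_expl // prime_gt1.
have lE : eHK p d'.+1 a t I = vol (closure (P_region phi calA calB t)).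
  exact/cvg_lim.
split => //.
- by apply/cvg_ex; eexists; exact: cvE.
- by rewrite lE.
Qed.
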